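(* Let $n>k\ge 1$ and let $F=(f^1,\dots,f^k):(\mathbb{C}^n,0)\to(\mathbb{C}^k,0)$ be a non-degenerate and convenient mixed map germ such that $V_F$ has positive dimension. Then $F$ is a mixed ICIS.
   Context: A mixed map germ $F=(f^1,\dots,f^k):(\mathbb{C}^n,0)\to(\mathbb{C}^k,0)$ is the germ at $0$ of a real analytic map with $F(0)=0$; its coordinates are written as convergent series $f(z,\bar z)=\sum_{\mu,\nu}\lambda_{\mu,\nu}z^\mu\bar z^\nu$. Put $V_F=F^{-1}(0)$ and let $\Sigma_F$ be the set of critical points of $F$, i.e. points where the rank of the real Jacobian matrix is not maximal ($<2k$). Statements about these sets are for germs at $0$. Mixed ICIS (mixed isolated complete intersection singularity): $n>k$, $V_F$ has positive dimension, and $\Sigma_F\cap V_F=\{0\}$. Notation: for nonempty $I\subset\{1,\dots,n\}$, $\mathbb{C}^I=\{z\in\mathbb{C}^n: z_i=0\ \forall i\notin I\}$, $f^I=f|_{\mathbb{C}^I}$; $\mathbb{C}^{*n}=(\mathbb{C}\setminus\{0\})^n$. For a mixed function $f=\sum\lambda_{\mu,\nu}z^\mu\bar z^\nu\not\equiv0$ and a vector $P=(p_1,\dots,p_n)$ of positive integers, let $d=\min\{\sum_i p_i(\mu_i+\nu_i):\lambda_{\mu,\nu}\neq0\}$; the face function is $f_P=\sum_{\sum_i p_i(\mu_i+\nu_i)=d}\lambda_{\mu,\nu}z^\mu\bar z^\nu$ (and $f_P=0$ if $f\equiv 0$). Put $F_P=(f^1_P,\dots,f^k_P)$. Gradients: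 $Df=(\partial f/\partial z_1,\dots,\partial f/\partial z_n)$, $\bar Df=(\partial f/\partial\bar z_1,\dots,\partial f/\partial\bar z_n)$. Non-degenerate: for every vector $P$ of positive integers and every $p\in\mathbb{C}^{*n}$ with $F_P(p)=0$, there is no $(\alpha_1,\dots,\alpha_k)\in\mathbb{C}^k\setminus\{0\}$ with $\sum_j\alpha_j\bar Df^j_P(p)=-\sum_j\bar\alpha_j\overline{Df^j_P(p)}$ (equivalently, $p$ is not a critical point of $F_P$). Convenient (for a map germ): for every $j=1,\dots,k$ and every nonempty $I\subset\{1,\dots,n\}$: (1) if $|I|>k$ then $f^{j,I}:=(f^j)^I\not\equiv0$; (2) if $|I|=k$ then $V_F\cap\mathbb{C}^I=\{0\}$.
   Formalization: In the definition of mixed ICIS, Σ_F∩V_F={0} is read as the inclusion of germs Σ_F∩V_F⊂{0}; the literal equality fails for F=z_1+z_2 (n=2, k=1), where Σ_F is empty. If 0 is a critical point, the inclusion gives the equality. *)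

(* Defs.v *)
(* MathComp-Analysis.  The real numbers are an arbitrary [R : realType], the
   complex numbers are [R[i]], and C^n is ['rV[R[i]]_n].  The copy [R[i]^o] of
   [R[i]] appears only where the topology of C or of C^n is used. *)
From HB Require Import structures.
From mathcomp Require Import all_boot all_order all_algebra.
From mathcomp Require Import all_classical all_reals all_analysis.
From mathcomp Require Import complex.

Set Implicit Arguments.
Unset Strict Implicit.
Unset Printing Implicit Defensive.

Import Order.TTheory GRing.Theory Num.Theory numFieldNormedType.Exports.

Local Open Scope classical_set_scope.
Local Open Scope ring_scope.
Local Open Scope complex_scope.

Section PowerSeries.
Variables (R : realType) (X : finType).

(* Coefficients of a complex power series in variables indexed by [X]; a
   multi-index is a function [X -> nat]. *)
Definition pseries := {ffun X -> nat} -> R[i].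

(* Absolute convergence on some polydisc centred at 0; the modulus [`|c m|]
   is a real element of [R[i]]. *)
Definition convergent (c : pseries) : Prop :=
  exists2 r : R, 0 < r &
    summable setT (fun m : {ffun X -> nat} =>
      (complex.Re `|c m| * r ^+ (\sum_x m x)%N)%:E).

Definition psum_upto (c : pseries) (w : X -> R[i]) (N : nat) : R[i] :=
  \sum_(m : {ffun X -> 'I_N})
     c [ffun x => nat_of_ord (m x)] * \prod_x w x ^+ m x.

(* The sum at [w].  The limit is meaningful where the series converges
   absolutely, hence near 0 for a convergent series, and everywhere for a
   series with finitely many nonzero coefficients. *)
Definition psum (c : pseries) (w : X -> R[i]) : R[i] :=
  limn (psum_upto c w : nat -> R[i]^o).

End PowerSeries.

Section Germs.
Variables (R : realType) (n : nat).

Definition germ_sub (A B : set 'rV[R[i]]_n) : Prop :=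
  \forall z \near (0 : 'rV[R[i]^o]_n), A z -> B z.

Definition germ_eq (A B : set 'rV[R[i]]_n) : Prop :=
  \forall z \near (0 : 'rV[R[i]^o]_n), A z <-> B z.

(* [A] contains a d-dimensional real analytic submanifold, given by a local
   parametrization [phi] which is a real analytic immersion germ at 0 of R^d.
   The coefficient of [phi i] at the j-th unit multi-index is the partial
   derivative of [phi i] with respect to the j-th coordinate, at 0. *)
Definition unit_index (d : nat) (j : 'I_d) : {ffun 'I_d -> nat} :=
  [ffun l => nat_of_bool (l == j)].

Definition contains_submanifold (A : set 'rV[R[i]]_n) (d : nat) : Prop :=
  exists phi : 'I_n -> pseries R 'I_d,
    [/\ forall i, convergent (phi i),
        \rank (row_mx
          (\matrix_(j < d, i < n) complex.Re (phi i (unit_index j)))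
          (\matrix_(j < d, i < n) complex.Im (phi i (unit_index j)))) = d &
        \forall t \near (0 : 'rV[R]_d),
          A (\row_i psum (phi i) (fun l => ((t : 'rV[R]_d) 0 l)%:C))].

Definition germ_dim_ge (A : set 'rV[R[i]]_n) (d : nat) : Prop :=
  forall U, nbhs (0 : 'rV[R[i]^o]_n) U -> contains_submanifold (A `&` U) d.

(* Real dimension of the germ of [A] at 0. *)
Definition germ_dim (A : set 'rV[R[i]]_n) (d : nat) : Prop :=
  germ_dim_ge A d /\ forall e, germ_dim_ge A e -> (e <= d)%N.

Definition positive_dim (A : set 'rV[R[i]]_n) : Prop :=
  exists2 d : nat, (0 < d)%N & germ_dim A d.

End Germs.

Section Derivatives.
Variables (R : realType) (n : nat).
Implicit Types (g : 'rV[R[i]]_n -> R[i]) (i : 'I_n) (z v : 'rV[R[i]]_n).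

(* Derivative at [z] of the complex-valued function [g] along the real
   direction [v]. *)
Definition dir_deriv g v z : R[i] :=
  derive1 (fun t : R => complex.Re (g (z + t%:C *: v))) 0
  +i* derive1 (fun t : R => complex.Im (g (z + t%:C *: v))) 0.

Definition pdx g i z : R[i] := dir_deriv g (delta_mx 0 i) z.
Definition pdy g i z : R[i] := dir_deriv g ('i%C *: delta_mx 0 i) z.

(* Wirtinger derivatives with respect to z_i and to its conjugate. *)
Definition dz g i z : R[i] := (pdx g i z - 'i%C * pdy g i z) / 2%:R.
Definition dzbar g i z : R[i] := (pdx g i z + 'i%C * pdy g i z) / 2%:R.

Variable k : nat.
Implicit Type G : 'I_k -> 'rV[R[i]]_n -> R[i].

(* Real coordinates: (x_1..x_n, y_1..y_n) in the source and
   (Re G_1..Re G_k, Im G_1..Im G_k) in the target. *)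
Definition real_jacobian G z : 'M[R]_(k + k, n + n) :=
  block_mx (\matrix_(j < k, i < n) complex.Re (pdx (G j) i z))
           (\matrix_(j < k, i < n) complex.Re (pdy (G j) i z))
           (\matrix_(j < k, i < n) complex.Im (pdx (G j) i z))
           (\matrix_(j < k, i < n) complex.Im (pdy (G j) i z)).

Definition critical_set G : set 'rV[R[i]]_n :=
  [set z | (\rank (real_jacobian G z) < k + k)%N].

Definition zero_set G : set 'rV[R[i]]_n := [set z | forall j, G j z = 0].

End Derivatives.

Section Mixed.
Variables (R : realType) (n : nat).

(* The coefficient of z^mu zbar^nu is the one at the multi-index [m] with
   [mu i = m (inl i)] and [nu i = m (inr i)]. *)
Definition mixed_series := pseries R ('I_n + 'I_n)%type.

Definition mixed_point (z : 'rV[R[i]]_n) (x : 'I_n + 'I_n) : R[i] :=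
  match x with inl i => z 0 i | inr i => conjc (z 0 i) end.

Definition mixed_eval (c : mixed_series) (z : 'rV[R[i]]_n) : R[i] :=
  psum c (mixed_point z).

Definition weight (P : 'I_n -> nat) (m : {ffun 'I_n + 'I_n -> nat}) : nat :=
  (\sum_i P i * (m (inl i) + m (inr i)))%N.

(* Keeps the terms whose weight is the least one among the nonzero terms. *)
Definition face_series (P : 'I_n -> nat) (c : mixed_series) : mixed_series :=
  fun m => if `[< forall m', c m' != 0 -> (weight P m <= weight P m')%N >]
           then c m else 0.

Definition face_fun (P : 'I_n -> nat) (c : mixed_series) :
  'rV[R[i]]_n -> R[i] := mixed_eval (face_series P c).

Definition coord_subspace (I : {set 'I_n}) : set 'rV[R[i]]_n :=
  [set z | forall i, i \notin I -> z 0 i = 0].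

End Mixed.

(* A real analytic map germ (C^n,0) -> (C^k,0) is given by the convergent
   expansions of its coordinates. *)
Record mixed_germ (R : realType) (n k : nat) := MixedGerm {
  germ_coef : 'I_k -> mixed_series R n;
  germ_convergent : forall j, convergent (germ_coef j);
  germ_at0 : forall j, mixed_eval (germ_coef j) 0 = 0
}.

Section MixedGermTheory.
Variables (R : realType) (n k : nat) (F : mixed_germ R n k).

Definition germ_fun (j : 'I_k) : 'rV[R[i]]_n -> R[i] :=
  mixed_eval (germ_coef F j).

Definition germ_face (P : 'I_n -> nat) (j : 'I_k) : 'rV[R[i]]_n -> R[i] :=
  face_fun P (germ_coef F j).

Definition V_ : set 'rV[R[i]]_n := zero_set germ_fun.
Definition Sigma_ : set 'rV[R[i]]_n := critical_set germ_fun.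

Definition nondegenerate_germ : Prop :=
  forall (P : 'I_n -> nat) (p : 'rV[R[i]]_n),
    (forall i, (0 < P i)%N) ->
    (forall i, p 0 i != 0) ->
    (forall j, germ_face P j p = 0) ->
    ~ exists2 a : 'rV[R[i]]_k, a != 0 &
        forall i : 'I_n,
          \sum_j a 0 j * dzbar (germ_face P j) i p =
          - \sum_j conjc (a 0 j) * conjc (dz (germ_face P j) i p).

Definition convenient_germ : Prop :=
  forall (j : 'I_k) (I : {set 'I_n}), (0 < #|I|)%N ->
    ((k < #|I|)%N ->
       ~ germ_sub (coord_subspace I) [set z | germ_fun j z = 0]) /\
    (#|I| = k -> germ_eq (V_ `&` coord_subspace I) [set 0]).

(* The condition on the critical points is an inclusion because a germ which
   is submersive at 0, such as z_1 + z_2 (n = 2, k = 1), has no critical point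
   at all near 0; 0 itself always belongs to [V_]. *)
Definition mixed_ICIS : Prop :=
  [/\ (k < n)%N, positive_dim V_ & germ_sub (Sigma_ `&` V_) [set 0]].

End MixedGermTheory.

(* Main.v *)
From HB Require Import structures.
From mathcomp Require Import all_boot all_order all_algebra.
From mathcomp Require Import all_classical all_reals all_analysis.
From mathcomp Require Import complex ring lra zify.
Require Import Defs.

(** The proof replaces the curve selection lemma by ultrafilters.  If 0 is not
    isolated in the set of critical zeros, there is an ultrafilter [U] converging
    to 0 that contains the set of critical zeros other than 0.  Along [U] every
    bounded real function converges, every property holds or fails, and so there
    is a set [I] such that [z_i] vanishes along [U] exactly for [i] outside [I].
    Convenience forces [#|I| > k], hence every component of the map has a term
    that does not vanish along [U].

    For each component [f^j], Dickson's lemma gives finitely many terms of which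
    every other relevant term is a proper multiple, hence negligible because
    [z -> 0] ([psum_leading]).  Among these finitely many terms, those of the
    largest order of magnitude along [U] are the leading ones.  The orders of
    magnitude of the moduli [|z_i|] live in an ordered vector space which is not
    archimedean in general, but only finitely many comparisons between exponents
    with integral coefficients matter.  By Fourier-Motzkin elimination
    ([fourier_motzkin]) the same comparisons hold for a vector [P] of positive
    integers ([leading_weight]); this vector has, for every component, the
    leading terms as its face.  Moreover the ratios of leading terms converge
    along [U], and their limits are the ratios of these terms at some point [p]
    of the torus ([leading_point]).

    Hence [f^j(z)] divided by the size of its leading terms tends to a nonzero
    multiple of [f^j_P(p)], and likewise for the logarithmic derivatives of
    [f^j] ([leading_limit], [dz_mixed_eval]).  The equation that expresses
    criticality at [z], with its covector rescaled by the sizes of the leading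
    terms and normalized, passes to the limit along [U] and shows that [p] is a
    critical zero of [F_P] ([degenerate_face]), against non-degeneracy. *)

Set Implicit Arguments.
Unset Strict Implicit.
Unset Printing Implicit Defensive.

Import Order.TTheory GRing.Theory Num.Theory numFieldNormedType.Exports.

Local Open Scope classical_set_scope.
Local Open Scope ring_scope.
Local Open Scope complex_scope.

(** * Complex modulus and limits *)

Section ComplexNorm.
Variable R : realType.
Implicit Types x y : R[i].

Lemma ReD x y : complex.Re (x + y) = complex.Re x + complex.Re y.
Proof. by case: x y => [? ?] [? ?]. Qed.

Lemma ImD x y : complex.Im (x + y) = complex.Im x + complex.Im y.
Proof. by case: x y => [? ?] [? ?]. Qed.

Lemma ReN x : complex.Re (- x) = - complex.Re x.
Proof. by case: x. Qed.

Lemma ImN x : complex.Im (- x) = - complex.Im x.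
Proof. by case: x. Qed.

Lemma ReM x y :
  complex.Re (x * y) = complex.Re x * complex.Re y - complex.Im x * complex.Im y.
Proof. by case: x y => [? ?] [? ?]. Qed.

Lemma ImM x y :
  complex.Im (x * y) = complex.Re x * complex.Im y + complex.Im x * complex.Re y.
Proof. by case: x y => [? ?] [? ?]. Qed.

Lemma complexP x y :
  complex.Re x = complex.Re y -> complex.Im x = complex.Im y -> x = y.
Proof. by case: x y => [? ?] [? ?] /= -> ->. Qed.

Lemma conjD x y : conjc (x + y) = conjc x + conjc y.
Proof.
by apply: complexP; rewrite /= ?ReD ?ImD; case: x y => [? ?] [? ?] //=; rewrite opprD.
Qed.

Lemma conjM x y : conjc (x * y) = conjc x * conjc y.
Proof. by case: x y => [? ?] [? ?]; apply: complexP => /=; ring. Qed.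

Lemma Re_sum (I : Type) (r : seq I) (P : pred I) (F : I -> R[i]) :
  complex.Re (\sum_(i <- r | P i) F i) = \sum_(i <- r | P i) complex.Re (F i).
Proof. exact: (big_morph _ ReD erefl). Qed.

Lemma Im_sum (I : Type) (r : seq I) (P : pred I) (F : I -> R[i]) :
  complex.Im (\sum_(i <- r | P i) F i) = \sum_(i <- r | P i) complex.Im (F i).
Proof. exact: (big_morph _ ImD erefl). Qed.

(** The modulus, as an element of [R]. *)
Definition cmod x : R := ComplexField.Normc.normc x.

Lemma cmodE x : cmod x = Num.sqrt (complex.Re x ^+ 2 + complex.Im x ^+ 2).
Proof. by case: x. Qed.

Lemma normrE x : `|x| = (cmod x)%:C.
Proof. by case: x. Qed.

Lemma cmod_ge0 x : 0 <= cmod x.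
Proof. by rewrite cmodE sqrtr_ge0. Qed.

Lemma cmod0 : cmod 0 = 0.
Proof. exact: ComplexField.Normc.normc0. Qed.

Lemma cmod1 : cmod 1 = 1.
Proof. exact: ComplexField.Normc.normc1. Qed.

Lemma cmodM x y : cmod (x * y) = cmod x * cmod y.
Proof. exact: ComplexField.Normc.normcM. Qed.

Lemma cmodV x : cmod x^-1 = (cmod x)^-1.
Proof. exact: ComplexField.Normc.normcV. Qed.

Lemma cmodD x y : cmod (x + y) <= cmod x + cmod y.
Proof. exact: le_normcD. Qed.

Lemma cmod_eq0 x : (cmod x == 0) = (x == 0).
Proof.
by apply/eqP/eqP => [/ComplexField.Normc.eq0_normc|->]; rewrite ?cmod0.
Qed.

Lemma cmod_gt0 x : (0 < cmod x) = (x != 0).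
Proof. by rewrite lt_def cmod_ge0 cmod_eq0 andbT. Qed.

Lemma cmod_real (a : R) : cmod a%:C = `|a|.
Proof. by rewrite cmodE /= expr0n addr0 sqrtr_sqr. Qed.

Lemma cmod_nat k : cmod k%:R = k%:R.
Proof. by rewrite -(rmorph_nat (real_complex R)) cmod_real ger0_norm. Qed.

Lemma cmodX x n : cmod (x ^+ n) = cmod x ^+ n.
Proof. by elim: n => [|n IH]; rewrite ?cmod1 // !exprS cmodM IH. Qed.

Lemma cmodJ x : cmod (conjc x) = cmod x.
Proof. by case: x => a b; rewrite !cmodE /= sqrrN. Qed.

Lemma cmod_prod (I : Type) (r : seq I) (P : pred I) (F : I -> R[i]) :
  cmod (\prod_(i <- r | P i) F i) = \prod_(i <- r | P i) cmod (F i).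
Proof. exact: (big_morph _ cmodM cmod1). Qed.

Lemma cmod_sum (I : Type) (r : seq I) (P : pred I) (F : I -> R[i]) :
  cmod (\sum_(i <- r | P i) F i) <= \sum_(i <- r | P i) cmod (F i).
Proof.
elim/big_rec2 : _ => [|i y x _ xy]; first by rewrite cmod0.
by apply: (le_trans (cmodD _ _)); rewrite lerD2l.
Qed.

Lemma Re_le_cmod x : `|complex.Re x| <= cmod x.
Proof.
rewrite cmodE -sqrtr_sqr ler_wsqrtr // lerDl sqr_ge0 //.
Qed.

Lemma Im_le_cmod x : `|complex.Im x| <= cmod x.
Proof.
rewrite cmodE -sqrtr_sqr ler_wsqrtr // lerDr sqr_ge0 //.
Qed.

Lemma ltC_Re (x e : R[i]) : 0 < e -> (`|x| < e) = (cmod x < complex.Re e).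
Proof.
case: e => a b; rewrite ltcE /= => /andP[/eqP -> a0].
by rewrite normrE ltcE /= eqxx.
Qed.

End ComplexNorm.

Section ComplexLimits.
Variables (R : realType) (T : Type) (F : set_system T).
Context {FF : ProperFilter F}.
Implicit Types (f g : T -> R[i]) (l : R[i]).

(** Convergence of a complex valued function along a filter, read on the real
    and imaginary parts, so that only limits of real functions are involved. *)
Definition ccvg f l : Prop :=
  (complex.Re (f t) @[t --> F] --> complex.Re l) /\
  (complex.Im (f t) @[t --> F] --> complex.Im l).

Lemma ccvg_cst l : ccvg (fun=> l) l.
Proof. by split; apply: cvg_cst. Qed.

Lemma ccvgD f g l l' : ccvg f l -> ccvg g l' ->
  ccvg (fun t => f t + g t) (l + l').
Proof.
move=> [fr fi] [gr gi]; split.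
  by rewrite ReD; under eq_fun do rewrite ReD; apply: cvgD.
by rewrite ImD; under eq_fun do rewrite ImD; apply: cvgD.
Qed.

Lemma ccvgN f l : ccvg f l -> ccvg (fun t => - f t) (- l).
Proof.
move=> [fr fi]; split.
  by rewrite ReN; under eq_fun do rewrite ReN; apply: cvgN.
by rewrite ImN; under eq_fun do rewrite ImN; apply: cvgN.
Qed.

Lemma ccvgM f g l l' : ccvg f l -> ccvg g l' ->
  ccvg (fun t => f t * g t) (l * l').
Proof.
move=> [fr fi] [gr gi]; split.
  rewrite ReM; under eq_fun do rewrite ReM.
  by apply: cvgB; apply: cvgM.
rewrite ImM; under eq_fun do rewrite ImM.
by apply: cvgD; apply: cvgM.
Qed.

Lemma ccvgJ f l : ccvg f l -> ccvg (fun t => conjc (f t)) (conjc l).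
Proof.
have E x : complex.Re (conjc x) = complex.Re x :> R by case: x.
have E' x : complex.Im (conjc x) = - complex.Im x :> R by case: x.
move=> [fr fi]; split.
  by rewrite E; under eq_fun do rewrite E.
by rewrite E'; under eq_fun do rewrite E'; apply: cvgN.
Qed.

Lemma ccvg_sum (I : Type) (r : seq I) (P : pred I) (f : I -> T -> R[i]) (l : I -> R[i]) :
  (forall i, P i -> ccvg (f i) (l i)) ->
  ccvg (fun t => \sum_(i <- r | P i) f i t) (\sum_(i <- r | P i) l i).
Proof.
move=> fl; elim: r => [|i r IH].
  by rewrite big_nil; under eq_fun do rewrite big_nil; exact: ccvg_cst.
rewrite big_cons; under eq_fun do rewrite big_cons.
case: ifP => // Pi; apply: ccvgD => //; exact: fl.
Qed.

Lemma ccvg_prod (I : Type) (r : seq I) (f : I -> T -> R[i]) (l : I -> R[i]) :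
  (forall i, ccvg (f i) (l i)) ->
  ccvg (fun t => \prod_(i <- r) f i t) (\prod_(i <- r) l i).
Proof.
move=> fl; elim: r => [|i r IH].
  by rewrite big_nil; under eq_fun do rewrite big_nil; exact: ccvg_cst.
rewrite big_cons; under eq_fun do rewrite big_cons.
by apply: ccvgM.
Qed.

Lemma ccvgX f l n : ccvg f l -> ccvg (fun t => f t ^+ n) (l ^+ n).
Proof.
move=> fl; elim: n => [|n IH].
  by rewrite expr0; under eq_fun do rewrite expr0; exact: ccvg_cst.
by rewrite exprS; under eq_fun do rewrite exprS; exact: ccvgM.
Qed.

Lemma ccvg_real (f : T -> R) (l : R) :
  f t @[t --> F] --> l -> ccvg (fun t => (f t)%:C) l%:C.
Proof. by move=> fl; split => //=; apply: cvg_cst. Qed.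

Lemma ccvg_near f g l : (\forall t \near F, f t = g t) -> ccvg f l -> ccvg g l.
Proof.
move=> fg [fr fi]; split.
  apply: cvg_trans fr; apply: near_eq_cvg.
  by apply: filterS fg => t /= ->.
apply: cvg_trans fi; apply: near_eq_cvg.
by apply: filterS fg => t /= ->.
Qed.

Lemma ccvg_unique f l l' : ccvg f l -> ccvg f l' -> l = l'.
Proof.
move=> [fr fi] [fr' fi']; apply: complexP.
  exact: (cvg_unique _ fr fr').
exact: (cvg_unique _ fi fi').
Qed.

Lemma ccvg_norm f l : ccvg f l -> cmod (f t) @[t --> F] --> cmod l.
Proof.
move=> [fr fi]; rewrite cmodE; under eq_fun do rewrite cmodE.
apply: (@cvg_comp _ _ _ (fun t => complex.Re (f t) ^+ 2 + complex.Im (f t) ^+ 2)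
   (@Num.sqrt R)); last exact: sqrt_continuous.
by apply: cvgD; rewrite !expr2; under eq_fun do rewrite expr2; apply: cvgM.
Qed.

Lemma ccvg_squeeze f l (h : T -> R) :
  (\forall t \near F, cmod (f t - l) <= h t) -> h t @[t --> F] --> 0 ->
  ccvg f l.
Proof.
move=> fh h0; split; apply/cvgrPdist_lt => e e0;
  move/cvgrPdist_lt/(_ e e0) : h0; apply: filterS2 fh => t fh;
  rewrite sub0r normrN => he.
  rewrite distrC -ReN -ReD; apply: le_lt_trans (Re_le_cmod _) _.
  by apply: le_lt_trans fh _; apply: le_lt_trans he; exact: ler_norm.
rewrite distrC -ImN -ImD; apply: le_lt_trans (Im_le_cmod _) _.
by apply: le_lt_trans fh _; apply: le_lt_trans he; exact: ler_norm.
Qed.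

Lemma ccvg_norm_le f l (C : R) :
  ccvg f l -> (\forall t \near F, cmod (f t) <= C) -> cmod l <= C.
Proof.
by move=> /ccvg_norm fl fC; apply: (cvgr_to_le fl).
Qed.

(** [ccvg] agrees with the topology of the complex numbers. *)
Lemma ccvgP f l : ccvg f l <-> (f : T -> R[i]^o) t @[t --> F] --> (l : R[i]^o).
Proof.
split=> [fl|/cvgrPdist_lt fl].
  have : ccvg (fun t => l - f t) 0.
    by rewrite -(subrr l); apply: ccvgD (ccvg_cst l) (ccvgN fl).
  move/ccvg_norm; rewrite cmod0 => /cvgrPdist_lt fl0.
  apply/cvgrPdist_lt => e e0.
  have re0 : 0 < complex.Re e by move: e0; case: (e) => a b; rewrite ltcE => /andP[].
  move: (fl0 _ re0); apply: filterS => t.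
  rewrite sub0r normrN ger0_norm ?cmod_ge0// => H.
  by rewrite (ltC_Re _ e0).
have H (e : R) : 0 < e -> \forall t \near F, cmod (l - f t) < e.
  move=> e0; have e0' : 0 < e%:C :> R[i] by rewrite ltcE /= eqxx.
  by move: (fl _ e0'); apply: filterS => t; rewrite ltC_Re.
split; apply/cvgrPdist_lt => e /H; apply: filterS => t; apply: le_lt_trans.
  by rewrite -ReN -ReD Re_le_cmod.
by rewrite -ImN -ImD Im_le_cmod.
Qed.

End ComplexLimits.

Section Ultra.
Variables (R : realType) (T : Type) (U : set_system T).
Context {UU : UltraFilter U}.

Lemma ultraNot (A : set T) : ~ U A -> U (~` A).
Proof. by move=> nA; case: (in_ultra_setVsetC A UU). Qed.

(** A bounded real function converges along an ultrafilter, by compactness of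
    segments. *)
Lemma ultra_bounded_cvg (f : T -> R) (M : R) :
  (\forall t \near U, `|f t| <= M) -> exists l : R, f t @[t --> U] --> l.
Proof.
move=> fM.
have fmapM : (f t @[t --> U]) `[- M, M]%classic.
  by rewrite /nbhs /=; apply: filterS fM => t; rewrite /= in_itv /= ler_norml.
have [l [_ fl]] := segment_compact (fmap_proper_filter f _) fmapM.
exists l => A lA.
have [//|UnA] := in_ultra_setVsetC (f @^-1` A) UU.
by have [x []] := fl (~` A) A UnA lA.
Qed.

End Ultra.

(** * Dickson's lemma and Fourier-Motzkin elimination *)

(** Dickson's lemma: every element of a set [S] of multi-indices dominates an
    element of some finite subset [E] of [S].  The proof is an induction on the
    variables in which the domination is required. *)
Lemma dickson (X : finType) (S : {ffun X -> nat} -> Prop) :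
  exists E : seq {ffun X -> nat}, (forall e, e \in E -> S e) /\
    (forall m, S m -> exists2 e, e \in E & forall x, (e x <= m x)%N).
Proof.
suff H (s : seq X) : exists E : seq {ffun X -> nat},
    (forall e, e \in E -> S e) /\ (forall m, S m ->
      exists2 e, e \in E & forall x, x \in s -> (e x <= m x)%N).
  have [E [ES Edom]] := H (enum X); exists E; split=> // m /Edom[e eE em].
  by exists e => // x; rewrite em // mem_enum.
elim: s S => [|x s IH] S.
  have [[e Se]|nS] := pselect (exists e, S e).
    exists [:: e]; split=> [e'|m _]; first by rewrite inE => /eqP ->.
    by exists e; rewrite ?inE.
  by exists [::]; split=> // m Sm; case: nS; exists m.
have [E0 [E0S E0dom]] := IH S.
pose M := (\max_(e <- E0) e x)%N.
(* Multi-indices whose [x]-exponent is at least [M] are handled by [E0]; each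
   of the finitely many smaller exponents gives a slice of [S]. *)
have slice v : exists Ev : seq {ffun X -> nat},
    (forall e, e \in Ev -> S e /\ e x = v) /\ (forall m, S m /\ m x = v ->
      exists2 e, e \in Ev & forall y, y \in s -> (e y <= m y)%N).
  exact: (IH (fun m => S m /\ m x = v)).
have [Es HEs] := boolp.choice slice.
exists (E0 ++ flatten [seq Es v | v <- iota 0 M]); split=> [e|m Sm].
  rewrite mem_cat => /orP[/E0S //|/flatten_mapP[v _ /(HEs v).1 []//]].
have [Mm|mM] := leqP M (m x).
  have [e eE em] := E0dom _ Sm; exists e; first by rewrite mem_cat eE.
  move=> y; rewrite inE => /orP[/eqP ->|/em //].
  by apply: leq_trans Mm; rewrite /M (big_rem e) //= leq_maxl.
have [e eE em] := (HEs (m x)).2 m (conj Sm erefl).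
exists e.
  rewrite mem_cat; apply/orP; right; apply/flatten_mapP; exists (m x) => //.
  by rewrite mem_iota.
by move=> y; rewrite inE => /orP[/eqP ->|/em //]; rewrite ((HEs (m x)).1 e eE).2.
Qed.

Section FourierMotzkin.

Lemma seq_max (K : realDomainType) (s : seq K) :
  exists M, forall x, x \in s -> x <= M.
Proof.
elim: s => [|x s [M HM]]; first by exists 0.
exists (Num.max x M) => y; rewrite inE => /orP[/eqP ->|/HM yM].
  by rewrite le_max lexx.
by rewrite le_max yM orbT.
Qed.

Lemma seq_max_mem (K : realDomainType) (x0 : K) (s : seq K) :
  exists2 M, M \in x0 :: s & forall x, x \in x0 :: s -> x <= M.
Proof.
elim: s x0 => [|x s IH] x0.
  by exists x0 => [|y]; rewrite inE // => /eqP ->.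
have [M HM MM] := IH x.
have [x0M|Mx0] := leP x0 M.
  by exists M => [|y]; rewrite inE ?HM ?orbT // => /orP[/eqP ->|/MM].
exists x0 => [|y]; rewrite inE ?eqxx // => /orP[/eqP -> //|/MM yM].
by rewrite (le_trans yM) // ltW.
Qed.

(* Existence of a value for an eliminated variable. *)
Lemma seq_between (K : realFieldType) (ls us : seq K) :
  (forall l u, l \in ls -> u \in us -> l < u) ->
  exists x, (forall l, l \in ls -> l < x) /\ (forall u, u \in us -> x < u).
Proof.
case: ls => [|l ls].
  move=> _; have [M HM] := seq_max (map -%R us); exists (- M - 1); split=> // u uu.
  by have := HM (- u) (map_f _ uu); lra.
case: us => [|u us].
  move=> _; have [M HM] := seq_max (l :: ls); exists (M + 1); split=> // x /HM.
  lra.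
move=> H.
have [M Ms HM] := seq_max_mem l ls.
have [N Ns HN] := seq_max_mem (- u) (map -%R us).
have {}Ns : - N \in u :: us.
  by rewrite -(mem_map (@oppr_inj K)) /= opprK.
have MN := H _ _ Ms Ns.
exists ((M - N) / 2); split=> [x /HM|x xs]; first by lra.
have /HN : - x \in map -%R (u :: us) by rewrite map_f.
lra.
Qed.

(** Transfer of linear constraints: [pos] and [zer] play the roles of the linear
    forms that are positive, respectively zero, at a point with values in some
    ordered vector space.  A finite system of strict inequalities and of
    equations with rational coefficients that is satisfied there is satisfied by
    a rational point.  The proof is elimination of variables. *)
Lemma fourier_motzkin n (pos zer : 'rV[rat]_n -> Prop)
    (posD : forall d e, pos d -> pos e -> pos (d + e))
    (posZ : forall a d, 0 < a -> pos d -> pos (a *: d))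
    (zerB : forall a d e, pos d -> zer e -> pos (d + a *: e))
    (zerZ : forall a d e, zer d -> zer e -> zer (d + a *: e))
    (pos0 : ~ pos 0)
    (L E : seq 'rV[rat]_n) :
  (forall d, d \in L -> pos d) -> (forall e, e \in E -> zer e) ->
  exists P : 'cV[rat]_n,
    (forall d, d \in L -> 0 < (d *m P) 0 0) /\
    (forall e, e \in E -> (e *m P) 0 0 = 0).
Proof.
elim: n => [|n IH] in pos zer posD posZ zerB zerZ pos0 L E *.
  move=> HL HE; exists 0; split=> [d /HL|e _]; last by rewrite mulmx0 mxE.
  by move=> pd; case: pos0; rewrite -(thinmx0 d).
move=> HL HE.
pose hd (d : 'rV[rat]_(1 + n)) : rat := lsubmx d 0 0.
pose tl (d : 'rV[rat]_(1 + n)) : 'rV[rat]_n := rsubmx d.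
pose ex (d : 'rV[rat]_n) : 'rV[rat]_(1 + n) := row_mx 0 d.
have hdD d e : hd (d + e) = hd d + hd e by rewrite /hd !mxE.
have hdZ a d : hd (a *: d) = a * hd d by rewrite /hd !mxE.
have exK d : hd d = 0 -> ex (tl d) = d.
  move=> d0; rewrite /ex /tl -[RHS]hsubmxK; congr row_mx.
  by apply/rowP => i; rewrite ord1 [RHS]d0 mxE.
have exD d e : ex (d + e) = ex d + ex e by rewrite /ex add_row_mx addr0.
have exZ a d : ex (a *: d) = a *: ex d by rewrite /ex scale_row_mx scaler0.
have dotE d (x : rat) P' :
    ((d : 'rV_(1 + n)) *m col_mx x%:M P') 0 0 = hd d * x + (tl d *m P') 0 0.
  rewrite -{1}(hsubmxK d) mul_row_col mxE; congr (_ + _).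
  by rewrite mul_mx_scalar mxE mulrC.
have ax (E' L' : seq 'rV[rat]_n) : (forall d, d \in L' -> pos (ex d)) ->
    (forall e, e \in E' -> zer (ex e)) ->
    exists P : 'cV[rat]_n,
      (forall d, d \in L' -> 0 < (d *m P) 0 0) /\
      (forall e, e \in E' -> (e *m P) 0 0 = 0).
  apply: (IH (pos \o ex) (zer \o ex)) => /=.
  - by move=> d e; rewrite exD; exact: posD.
  - by move=> a d; rewrite exZ; exact: posZ.
  - by move=> a d e; rewrite exD exZ; exact: zerB.
  - by move=> a d e; rewrite exD exZ; exact: zerZ.
  - by rewrite /ex row_mx0.
(* If the first variable occurs in an equation, that equation eliminates it. *)
have [[e0 e0E e00]|E0] := pselect (exists2 e, e \in E & hd e != 0).
  pose rd d := d - (hd d / hd e0) *: e0.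
  have hrd d : hd (rd d) = 0.
    by rewrite /rd -scaleNr hdD hdZ mulNr mulfVK // subrr.
  have [||P' [HL' HE']] := ax [seq tl (rd e) | e <- E] [seq tl (rd d) | d <- L].
  - move=> _ /mapP[d dL ->]; rewrite exK // /rd -scaleNr.
    by apply: zerB; [exact: HL|exact: HE].
  - move=> _ /mapP[d dL ->]; rewrite exK // /rd -scaleNr.
    by apply: zerZ; exact: HE.
  pose x := - (tl e0 *m P') 0 0 / hd e0.
  have Hx d : ((d : 'rV_(1 + n)) *m col_mx x%:M P') 0 0 = (tl (rd d) *m P') 0 0.
    have e0x : (e0 *m col_mx x%:M P') 0 0 = 0.
      by rewrite dotE /x mulrC mulfVK // addNr.
    have := dotE (rd d) x P'; rewrite hrd mul0r add0r => <-.
    rewrite /rd mulmxBl -scalemxAl [RHS]mxE [X in _ + X]mxE [X in _ - X]mxE.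
    by rewrite e0x mulr0 subr0.
  exists (col_mx x%:M P'); split=> [d dL|e eE]; rewrite Hx.
    by apply: HL'; apply/mapP; exists d.
  by apply: HE'; apply/mapP; exists e.
have {}E0 e : e \in E -> hd e = 0.
  by move=> eE; apply/eqP/negP => /negP e0; apply: E0; exists e.
(* Otherwise it is eliminated by combining each inequality that bounds it from
   below with each one that bounds it from above. *)
pose Lp := [seq d <- L | 0 < hd d]; pose Ln := [seq d <- L | hd d < 0].
pose L0 := [seq d <- L | hd d == 0].
have [||P' [HL' HE']] := ax (map tl E)
  (map tl L0 ++ [seq tl (hd p *: q - hd q *: p) | p <- Lp, q <- Ln]).
- move=> d; rewrite mem_cat => /orP[/mapP[e]|/allpairsP[[p q] /= []]].
    by rewrite mem_filter => /andP[/eqP e0 /HL eL] ->; rewrite exK.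
  rewrite !mem_filter => /andP[p0 /HL pL] /andP[q0 /HL qL] ->.
  rewrite exK; last by rewrite -scaleNr hdD !hdZ mulNr mulrC subrr.
  by rewrite -scaleNr; apply: posD; apply: posZ; rewrite // oppr_gt0.
- by move=> _ /mapP[e eE ->]; rewrite exK ?E0 //; exact: HE.
pose bd (d : 'rV[rat]_(1 + n)) := - (tl d *m P') 0 0 / hd d.
have [|x [Hl Hu]] := @seq_between _ (map bd Lp) (map bd Ln).
  move=> _ _ /mapP[p pL ->] /mapP[q qL ->].
  have : 0 < (tl (hd p *: q - hd q *: p) *m P') 0 0.
    by apply: HL'; rewrite mem_cat; apply/orP; right; apply/allpairsP; exists (p, q).
  move: pL qL; rewrite !mem_filter => /andP[p0 pL] /andP[q0 qL].
  have -> : (tl (hd p *: q - hd q *: p) *m P') 0 0 =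
     hd p * (tl q *m P') 0 0 - hd q * (tl p *m P') 0 0.
    have -> : tl (hd p *: q - hd q *: p) = hd p *: tl q - hd q *: tl p.
      by apply/rowP => i; rewrite !mxE.
    rewrite mulmxBl -!scalemxAl [LHS]mxE.
    by rewrite [X in X + _ = _]mxE [X in _ + X = _]mxE [X in _ - X = _]mxE.
  rewrite /bd ltr_pdivrMr // mulrAC ltr_ndivlMr //.
  lra.
exists (col_mx x%:M P'); split=> [d dL|e eE]; rewrite dotE.
  have [d0|d0|d0] := ltrgtP (hd d) 0.
  - have /Hu : bd d \in map bd Ln by rewrite map_f // mem_filter d0.
    by rewrite /bd ltr_ndivlMr //; lra.
  - have /Hl : bd d \in map bd Lp by rewrite map_f // mem_filter d0.
    by rewrite /bd ltr_pdivrMr //; lra.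
  - rewrite d0 mul0r add0r; apply: HL'; rewrite mem_cat map_f //.
    by rewrite mem_filter d0 eqxx.
by rewrite E0 // mul0r add0r; apply: HE'; rewrite map_f.
Qed.

Lemma clear_denominators n (P : 'cV[rat]_n) : (forall i, 0 < P i 0) ->
  exists Q : 'I_n -> nat, exists2 N : rat, 0 < N & forall i, (Q i)%:R = N * P i 0.
Proof.
move=> P0; pose N : int := \prod_i denq (P i 0).
exists (fun i => absz (numq (P i 0) * \prod_(j | j != i) denq (P j 0))).
have dp (A : pred 'I_n) : 0 < \prod_(j | A j) denq (P j 0).
  by apply: prodr_gt0 => j _; exact: denq_gt0.
exists N%:~R => [|i]; first by rewrite ltr0z; exact: dp.
rewrite pmulrn gez0_abs; last first.
  by rewrite mulr_ge0 ?(ltW (dp _)) // ?numq_ge0 ltW.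
have -> : N = denq (P i 0) * \prod_(j | j != i) denq (P j 0) by rewrite /N (bigD1 i).
rewrite !intrM -[X in _ = _ * X]divq_num_den.
have : (denq (P i 0))%:~R != 0 :> rat by rewrite intr_eq0 denq_neq0.
move: (numq _)%:~R (denq _)%:~R (\prod_(_ | _) _)%:~R => a b c b0.
by field.
Qed.

End FourierMotzkin.

(** * Power series in several variables *)

Section PowerSeriesSums.
Variables (R : realType) (X : finType).
Implicit Types (c : pseries R X) (w : X -> R[i]) (m e : {ffun X -> nat}).

(** Total degree of a multi-index, and the monomial with this multi-index. *)
Definition mdeg m : nat := (\sum_x m x)%N.
Definition mono w m : R[i] := \prod_x w x ^+ m x.

(** The multi-indices with all entries less than [N], over which [psum_upto]
    sums. *)
Definition box N : seq {ffun X -> nat} :=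
  [seq [ffun x => nat_of_ord (m x)] | m : {ffun X -> 'I_N}].

Lemma psum_uptoE c w N : psum_upto c w N = \sum_(m <- box N) c m * mono w m.
Proof.
rewrite /box big_image /=; apply: eq_bigr => m _; congr (_ * _).
by apply: eq_bigr => x _; rewrite ffunE.
Qed.

Lemma box_uniq N : uniq (box N).
Proof.
rewrite map_inj_uniq ?enum_uniq // => m m' /ffunP mm'.
by apply/ffunP => x; apply/val_inj; have := mm' x; rewrite !ffunE.
Qed.

Lemma mem_box N m : (m \in box N) = [forall x, m x < N]%N.
Proof.
apply/mapP/forallP => [[m' _ -> x]|mN]; first by rewrite ffunE.
exists [ffun x => Ordinal (mN x)]; first by rewrite mem_enum.
by apply/ffunP => x; rewrite !ffunE.
Qed.

Lemma leq_mdeg m x : (m x <= mdeg m)%N.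
Proof. by rewrite /mdeg (bigD1 x) //= leq_addr. Qed.

Lemma cmod_mono w m : cmod (mono w m) = \prod_x cmod (w x) ^+ m x.
Proof. by rewrite cmod_prod; apply: eq_bigr => x _; rewrite cmodX. Qed.

Lemma mono_le w m r : (forall x, cmod (w x) <= r) -> cmod (mono w m) <= r ^+ mdeg m.
Proof.
move=> wr; rewrite cmod_mono /mdeg.
rewrite (big_morph (fun k => r ^+ k) (exprD r) (expr0 r)).
apply: ler_prod => x _; rewrite exprn_ge0 ?cmod_ge0 //=.
by apply: lerXn2r; rewrite ?nnegrE ?cmod_ge0 // (le_trans _ (wr x)) ?cmod_ge0.
Qed.

Lemma uniq_sum_le (h : {ffun X -> nat} -> R) (s s' : seq {ffun X -> nat}) :
  (forall m, 0 <= h m) -> uniq s -> uniq s' -> {subset s <= s'} ->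
  \sum_(m <- s) h m <= \sum_(m <- s') h m.
Proof.
move=> h0 us us' ss'.
have -> : \sum_(m <- s) h m = \sum_(m <- s' | m \in s) h m.
  rewrite -[RHS]big_filter; apply: perm_big; apply: uniq_perm => //.
    exact: filter_uniq.
  move=> m; rewrite mem_filter; case: (boolP (m \in s)) => // /ss' ->//.
by rewrite [leRHS](bigID (fun m => m \in s)) /= lerDl sumr_ge0.
Qed.

Lemma box_mono N N' : (N <= N')%N -> {subset box N <= box N'}.
Proof.
move=> NN' m; rewrite !mem_box => /forallP mN; apply/forallP => x.
exact: leq_trans (mN x) NN'.
Qed.

(* Both [|h|] and [h + |h|] have nondecreasing bounded sums along boxes. *)
Lemma box_sum_cvg (h : {ffun X -> nat} -> R) (K : R) :
  (forall s, uniq s -> \sum_(m <- s) `|h m| <= K) ->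
  exists l : R, \sum_(m <- box N) h m @[N --> \oo] --> l.
Proof.
move=> hK.
have cvg_nneg (g : {ffun X -> nat} -> R) (B : R) : (forall m, 0 <= g m) ->
    (forall s, uniq s -> \sum_(m <- s) g m <= B) ->
    cvg (\sum_(m <- box N) g m @[N --> \oo]).
  move=> g0 gB; apply: nondecreasing_is_cvgn.
    by move=> N N' NN'; apply: uniq_sum_le; rewrite ?box_uniq //; exact: box_mono.
  by exists B => _ [N _ <-]; apply: gB; exact: box_uniq.
have c1 := cvg_nneg _ K (fun m => normr_ge0 (h m)) hK.
have c2 : cvg (\sum_(m <- box N) (h m + `|h m|) @[N --> \oo]).
  apply: (@cvg_nneg _ (K + K)).
    by move=> m; have := ler_norm (- h m); rewrite normrN; lra.
  move=> s us; rewrite big_split /=; apply: lerD; last exact: hK.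
  by apply: le_trans (hK s us); apply: ler_sum => m _; exact: ler_norm.
have -> : (fun N => \sum_(m <- box N) h m) =
    (fun N => \sum_(m <- box N) (h m + `|h m|)) - (fun N => \sum_(m <- box N) `|h m|).
  apply/funext => N; apply: (etrans _ (sumrB _ _ _ _)).
  by apply: eq_bigr => m _; rewrite addrK.
by eexists; exact: cvgB c2 c1.
Qed.

(** [summable_at c r K]: the moduli of the terms of [c] at a point all of whose
    coordinates have modulus [r] have finite sums at most [K]. *)
Definition summable_at c (r K : R) : Prop :=
  forall s, uniq s -> \sum_(m <- s) cmod (c m) * r ^+ mdeg m <= K.

Lemma convergent_summable c : convergent c ->
  exists r K : R, 0 < r /\ summable_at c r K.
Proof.
move=> [r r0]; rewrite /summable.
set S := esum _ _ => Sfin.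
have S0 : (0 <= S)%E by apply: esum_ge0 => m _; rewrite lee_fin normr_ge0.
exists r, (fine S); split=> // s us.
rewrite -lee_fin fineK; last by rewrite ge0_fin_numE.
apply: esum_ge; exists [set` s]; first by split=> //; exact: finite_seq.
rewrite -fsbig_seq // -sumEFin; apply: lee_sum => m _.
rewrite gee0_abs; first by rewrite lee_fin normrE.
by rewrite lee_fin mulr_ge0 ?exprn_ge0 ?(ltW r0) //; rewrite normrE cmod_ge0.
Qed.

Lemma summable_le c c' r r' K :
  (forall m, cmod (c' m) * r' ^+ mdeg m <= cmod (c m) * r ^+ mdeg m) ->
  summable_at c r K -> summable_at c' r' K.
Proof.
by move=> cc' cK s us; apply: le_trans (cK s us); exact: ler_sum.
Qed.

Lemma summable_finite c (r : R) (E : seq {ffun X -> nat}) : 0 <= r -> uniq E ->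
  (forall m, c m != 0 -> m \in E) ->
  summable_at c r (\sum_(m <- E) cmod (c m) * r ^+ mdeg m).
Proof.
move=> r0 uE cE s us.
rewrite (bigID (fun m => m \in E)) /= [X in _ + X]big1 ?addr0; last first.
  move=> m mE; have [->|/cE] := eqVneq (c m) 0; first by rewrite cmod0 mul0r.
  by rewrite (negbTE mE).
rewrite -big_filter; apply: uniq_sum_le => //.
- by move=> m; rewrite mulr_ge0 ?cmod_ge0 ?exprn_ge0.
- exact: filter_uniq.
- by move=> m; rewrite mem_filter => /andP[].
Qed.

Lemma psum_lim c w l : ccvg \oo (psum_upto c w) l -> psum c w = l.
Proof. by move=> /ccvgP H; apply: (cvg_lim _ H); exact: norm_hausdorff. Qed.

Lemma psum_cvg c w r K : (forall x, cmod (w x) <= r) -> summable_at c r K ->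
  ccvg \oo (psum_upto c w) (psum c w).
Proof.
move=> wr cK.
have bnd (s : seq {ffun X -> nat}) : uniq s ->
    \sum_(m <- s) cmod (c m * mono w m) <= K.
  move=> /cK; apply: le_trans; apply: ler_sum => m _.
  by rewrite cmodM ler_wpM2l ?cmod_ge0 ?mono_le.
have [|lr Hr] := @box_sum_cvg (fun m => complex.Re (c m * mono w m)) K.
  move=> s /bnd; apply: le_trans; apply: ler_sum => m _; exact: Re_le_cmod.
have [|li Hi] := @box_sum_cvg (fun m => complex.Im (c m * mono w m)) K.
  move=> s /bnd; apply: le_trans; apply: ler_sum => m _; exact: Im_le_cmod.
suff H : ccvg \oo (psum_upto c w) (lr +i* li) by rewrite (psum_lim H).
split.
  by under eq_fun do rewrite psum_uptoE Re_sum.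
by under eq_fun do rewrite psum_uptoE Im_sum.
Qed.

Lemma psum_eq0 c w : (forall m, c m * mono w m = 0) -> psum c w = 0.
Proof.
move=> c0; apply: psum_lim.
have -> : psum_upto c w = (fun=> 0).
  by apply/funext => N; rewrite psum_uptoE big1.
exact: ccvg_cst.
Qed.

Lemma psum_finite c w (E : seq {ffun X -> nat}) : uniq E ->
  (forall m, c m != 0 -> m \in E) ->
  psum c w = \sum_(m <- E) c m * mono w m.
Proof.
move=> uE cE; apply: psum_lim.
apply: ccvg_near (ccvg_cst _); exists (\max_(m <- E) mdeg m).+1 => // N /= EN.
apply/esym; rewrite psum_uptoE (bigID (fun m => m \in E)) /= addrC big1 ?add0r; last first.
  move=> m mE; have [->|/cE] := eqVneq (c m) 0; first by rewrite mul0r.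
  by rewrite (negbTE mE).
rewrite -[LHS]big_filter; apply: perm_big; apply: uniq_perm => //.
  by rewrite filter_uniq ?box_uniq.
move=> m; rewrite mem_filter; case: (boolP (m \in E)) => //= mE.
rewrite mem_box; apply/forallP => x; apply: leq_trans EN.
by rewrite ltnS (leq_trans (leq_mdeg m x)) // (big_rem m) //= leq_maxl.
Qed.

(** The leading part of a series at a point [w]: if every term that is nonzero
    at [w] is divisible by a monomial from the finite set [E], then the terms
    outside [E] contribute [O(eps)] times a bound [T] of the monomials from [E],
    where [eps] bounds the variables. *)
Lemma psum_leading c (rho K : R) (E : seq {ffun X -> nat}) (M : nat) :
  0 < rho -> rho <= 1 -> summable_at c rho K ->
  uniq E -> (forall e, e \in E -> (mdeg e <= M)%N) ->
  forall w (eps T : R),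
    eps <= rho -> (forall x, cmod (w x) <= eps) -> 0 <= eps ->
    0 <= T -> (forall e, e \in E -> cmod (mono w e) <= T) ->
    (forall m, c m * mono w m != 0 -> exists2 e, e \in E & forall x, (e x <= m x)%N) ->
  cmod (psum c w - \sum_(m <- E) c m * mono w m) <= T * eps * (rho ^- M.+1 * K).
Proof.
move=> rho0 rho1 cK uE EM w eps T epsrho weps eps0 T0 ET Edom.
have wrho x : cmod (w x) <= rho by exact: le_trans (weps x) epsrho.
have wc := psum_cvg wrho cK.
apply: (ccvg_norm_le (ccvgD wc (ccvgN (ccvg_cst _)))).
exists M.+1 => // N /= MN.
have Ebox : {subset E <= box N}.
  move=> e /EM eM; rewrite mem_box; apply/forallP => x; apply: leq_trans MN.
  by rewrite ltnS (leq_trans (leq_mdeg e x)).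
rewrite psum_uptoE (bigID (fun m => m \in E)) /=.
have -> : \sum_(m <- box N | m \in E) c m * mono w m = \sum_(m <- E) c m * mono w m.
  rewrite -[LHS]big_filter; apply: perm_big; apply: uniq_perm => //.
    by rewrite filter_uniq ?box_uniq.
  by move=> m; rewrite mem_filter; case: (boolP (m \in E)) => //= /Ebox.
rewrite [X in cmod X]addrC addKr.
apply: (le_trans (cmod_sum _ _ _)).
have Ku : \sum_(m <- box N | m \notin E) cmod (c m) * rho ^+ mdeg m <= K.
  by rewrite -big_filter; apply: cK; rewrite filter_uniq ?box_uniq.
have C0 : 0 <= T * eps * rho ^- M.+1.
  by rewrite !mulr_ge0 // invr_ge0 exprn_ge0 // ltW.
apply: (@le_trans _ _ (\sum_(m <- box N | m \notin E)
    T * eps * rho ^- M.+1 * (cmod (c m) * rho ^+ mdeg m))); last first.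
  by rewrite -mulr_sumr [leRHS]mulrA ler_wpM2l.
apply: ler_sum => m mE.
have [->|m0] := eqVneq (c m * mono w m) 0.
  by rewrite cmod0 mulr_ge0 // mulr_ge0 ?cmod_ge0 // exprn_ge0 // ltW.
(* Such a term is a proper multiple of a monomial from [E]. *)
have [e eE em] := Edom m m0.
rewrite cmodM mulrCA ler_wpM2l ?cmod_ge0 //.
pose d : {ffun X -> nat} := [ffun x => (m x - e x)%N].
have md : mono w m = mono w e * mono w d.
  rewrite /mono -big_split /=; apply: eq_bigr => x _.
  by rewrite ffunE -exprD subnKC.
have degm : mdeg m = (mdeg e + mdeg d)%N.
  rewrite /mdeg -big_split /=; apply: eq_bigr => x _.
  by rewrite ffunE subnKC.
have d0 : (0 < mdeg d)%N.
  rewrite lt0n; apply: contra mE => /eqP d0; suff -> : m = e by [].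
  apply/ffunP => x; apply/eqP; rewrite eqn_leq em andbT.
  by have := leq_mdeg d x; rewrite d0 leqn0 ffunE subn_eq0.
rewrite md cmodM -2!mulrA; apply: ler_pM; rewrite ?cmod_ge0 ?ET //.
apply: (le_trans (mono_le _ weps)).
rewrite -(prednK d0) [eps ^+ _]exprS -mulrA; apply: ler_wpM2l => //.
apply: (@le_trans _ _ (rho ^+ (mdeg d).-1)).
  by apply: lerXn2r; rewrite ?nnegrE // ltW.
rewrite ler_pdivlMl ?exprn_gt0 // -exprD.
apply: ler_wiXn2l => //; first exact: ltW.
by rewrite degm addSn -addnS prednK // leq_add2r EM.
Qed.

End PowerSeriesSums.

(** * Logarithmic derivatives of mixed series *)

Section LogDerivatives.
Variable R : realType.

(* The constants are those for which the induction on the number [N] of factors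
   goes through. *)
Lemma expand_step (E D y : R[i]) (tau : R) (N : nat) :
  0 <= tau <= 1 -> cmod y <= tau -> cmod D <= N%:R * tau ->
  cmod (E - 1 - D) <= tau ^+ 2 * (2 ^+ N - 1 - N%:R) ->
  cmod (E * (1 + y) - 1 - (D + y)) <= tau ^+ 2 * (2 ^+ N.+1 - 1 - N.+1%:R).
Proof.
move=> /andP[t0 t1] yt Dt Et.
have -> : E * (1 + y) - 1 - (D + y) = (E - 1 - D) * (1 + y) + D * y by ring.
apply: (le_trans (cmodD _ _)); rewrite !cmodM.
have y2 : cmod (1 + y) <= 2.
  apply: (le_trans (cmodD _ _)); rewrite cmod1.
  by lra.
have h1 : cmod (E - 1 - D) * cmod (1 + y) <= tau ^+ 2 * (2 ^+ N - 1 - N%:R) * 2.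
  by apply: ler_pM => //; exact: cmod_ge0.
have h2 : cmod D * cmod y <= N%:R * tau * tau.
  by apply: ler_pM => //; exact: cmod_ge0.
apply: (le_trans (lerD h1 h2)).
rewrite le_eqVlt; apply/orP; left; apply/eqP.
by rewrite [2 ^+ N.+1]exprS -natr1; ring.
Qed.

(** Second order estimate for a product of [a + b] factors [1 + y]. *)
Lemma expand_estimate (y1 y2 : R[i]) (tau : R) (a b : nat) :
  0 <= tau <= 1 -> cmod y1 <= tau -> cmod y2 <= tau ->
  cmod ((1 + y1) ^+ a * (1 + y2) ^+ b - 1 - (a%:R * y1 + b%:R * y2))
    <= tau ^+ 2 * 2 ^+ (a + b).
Proof.
move=> t01 y1t y2t.
have [/andP[t0 t1]] := t01.
suff H : cmod ((1 + y1) ^+ a * (1 + y2) ^+ b - 1 - (a%:R * y1 + b%:R * y2))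
    <= tau ^+ 2 * (2 ^+ (a + b) - 1 - (a + b)%:R).
  apply: le_trans H _; rewrite ler_wpM2l ?sqr_ge0 //.
  by have : 0 <= (a + b)%:R :> R by []; lra.
elim: b => [|b IH].
  rewrite addn0 expr0 mulr1 mul0r addr0.
  elim: a => [|a IH]; first by rewrite !expr0 mul0r !subrr ?subr0 cmod0 mulr0.
  rewrite -[a.+1%:R]natr1 mulrDl mul1r exprSr; apply: expand_step => //.
  by rewrite cmodM cmod_nat ler_wpM2l.
rewrite addnS -[b.+1%:R]natr1 mulrDl mul1r exprSr !mulrA addrA.
apply: expand_step => //.
apply: (le_trans (cmodD _ _)); rewrite !cmodM !cmod_nat natrD mulrDl.
by apply: lerD; rewrite ler_wpM2l.
Qed.

Lemma derive1_quadratic (g : R -> R) (D C s : R) : 0 < s ->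
  (forall t, `|t| <= s -> `|g t - g 0 - t * D| <= t ^+ 2 * C) ->
  derive1 g 0 = D.
Proof.
move=> s0 H; rewrite /derive1; apply: cvg_lim; first exact: norm_hausdorff.
apply/cvgrPdist_le => e e0.
have C0 : 0 <= `|C| + 1 by rewrite addr_ge0.
have d0 : 0 < Num.min s (e / (`|C| + 1)).
  by rewrite lt_min s0 divr_gt0 // ltr_wpDl.
have := @dnbhs0_le _ R^o _ d0.
apply: filterS2 (nbhs_dnbhs_neq 0) => h h0.
rewrite le_min => /andP[hs he]; rewrite addr0 /=.
have hn : 0 < `|h| by rewrite normr_gt0.
have -> : D - h^-1 *: (g h - g 0) = - (h^-1 * (g h - g 0 - h * D)).
  rewrite -[h^-1 *: _]/(h^-1 * _); by field.
rewrite normrN normrM normfV ler_pdivrMl //.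
apply: (le_trans (H h hs)); rewrite -real_normK ?num_real // expr2 -mulrA.
rewrite ler_pM2l //.
apply: (@le_trans _ _ (`|h| * (`|C| + 1))).
  by rewrite ler_wpM2l // (le_trans (ler_norm C)) // lerDl.
by rewrite -ler_pdivlMr // ltr_wpDl.
Qed.

Variable n : nat.
Implicit Types (c : mixed_series R n) (z : 'rV[R[i]]_n) (i : 'I_n).

(** [euler x c] is the series obtained by applying the Euler operator
    [w_x d/dw_x] to [c]. *)
Definition euler (x : 'I_n + 'I_n) c : mixed_series R n := fun m => (m x)%:R * c m.

Lemma summable_euler x c (rho K : R) : 0 <= rho ->
  summable_at c rho K -> summable_at (euler x c) (rho / 2) K.
Proof.
move=> r0; apply: summable_le => m.
rewrite (_ : cmod _ * _ = cmod (c m) * rho ^+ mdeg m * ((m x)%:R / 2 ^+ mdeg m));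
  last by rewrite /euler cmodM cmod_nat expr_div_n; ring.
rewrite ler_piMr ?mulr_ge0 ?exprn_ge0 ?cmod_ge0 // ler_pdivrMr ?exprn_gt0 // mul1r.
rewrite -natrX ler_nat (leq_trans (leq_mdeg m x)) //.
by apply: ltnW; exact: ltn_expl.
Qed.

Lemma mixed_point_cmod z x : cmod (mixed_point z x) =
  match x with inl i => cmod (z 0 i) | inr i => cmod (z 0 i) end.
Proof. by case: x => i //=; exact: cmodJ. Qed.

(** The line through [z] in the direction of the [i]-th coordinate multiplied by
    the complex number [xi]. *)
Definition shift z i (xi : R[i]) (t : R) := z + t%:C *: (xi *: delta_mx 0 i).

Lemma mono_shift z i (xi : R[i]) (t : R) m : z 0 i != 0 ->
  mono (mixed_point (shift z i xi t)) m = mono (mixed_point z) m *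
    ((1 + t%:C * (xi / z 0 i)) ^+ m (inl i) *
     (1 + t%:C * conjc (xi / z 0 i)) ^+ m (inr i)).
Proof.
move=> zi0.
have E x : mixed_point (shift z i xi t) x = mixed_point z x *
    ((if x == inl i then 1 + t%:C * (xi / z 0 i) else 1) *
     (if x == inr i then 1 + t%:C * conjc (xi / z 0 i) else 1)).
  have Ei k : shift z i xi t 0 k = z 0 k + (if k == i then t%:C * xi else 0).
    rewrite /shift !mxE eqxx /=; case: eqP => _; first by rewrite mulr1.
    by rewrite !mulr0.
  have conjt : conjc (t%:C) = t%:C by exact: conjc_real.
  case: x => k /=; rewrite Ei.
    have -> : (inl k == inl i :> 'I_n + 'I_n) = (k == i) by [].
    case: eqP => [->|_]; last by rewrite addr0 !mulr1.
    by rewrite mulr1 mulrDr mulr1 mulrCA [z 0 i * _]mulrC mulfVK.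
  have -> : (inr k == inr i :> 'I_n + 'I_n) = (k == i) by [].
  rewrite mul1r; case: eqP => [->|_]; last by rewrite addr0 !mulr1.
  rewrite conjD !conjM conjt conjc_inv.
  have : conjc (z 0 i) != 0 by rewrite conjc_eq0.
  by move: (conjc _) (conjc _) => a b a0; field.
rewrite /mono.
under eq_bigr do rewrite E !exprMn.
rewrite !big_split /=; congr (_ * (_ * _)).
  rewrite (bigD1 (inl i)) //= eqxx big1 ?mulr1 // => x /negbTE ->.
  by rewrite expr1n.
by rewrite (bigD1 (inr i)) //= eqxx big1 ?mulr1 // => x /negbTE ->; rewrite expr1n.
Qed.

(* The first order remainder of one term of the series. *)
Lemma remainder_identity (c P u v a b t x y : R[i]) :
  c * (P * (u * v)) - c * P - t * (x * (a * c * P) + y * (b * c * P)) =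
  c * P * (u * v - 1 - (a * (t * x) + b * (t * y))).
Proof. by ring. Qed.

(** Termwise differentiation in a coordinate direction, at a point where this
    coordinate does not vanish: each term is [1 + t zeta] to some power times
    [1 + t conj zeta] to another one, up to a constant factor. *)
Lemma dir_deriv_mixed_eval c (rho K : R) z i (xi : R[i]) :
  summable_at c rho K -> (forall k, cmod (z 0 k) <= rho / 2) -> z 0 i != 0 ->
  cmod xi = 1 ->
  dir_deriv (mixed_eval c) (xi *: delta_mx 0 i) z =
    xi / z 0 i * psum (euler (inl i) c) (mixed_point z)
    + conjc (xi / z 0 i) * psum (euler (inr i) c) (mixed_point z).
Proof.
move=> cK zr zi0 xi1.
set zeta := xi / z 0 i; set A := psum _ _; set B := psum _ _.
have s0 : 0 < cmod (z 0 i) by rewrite cmod_gt0.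
set s := cmod (z 0 i) in s0.
have nzeta : cmod zeta = s^-1 by rewrite cmodM cmodV xi1 mul1r.
have rho0 : 0 <= rho.
  by have := le_trans (ltW s0) (zr i); rewrite pmulr_lge0.
have zr' x : cmod (mixed_point z x) <= rho / 2.
  by rewrite mixed_point_cmod; case: x.
have cK' : summable_at c (rho / 2) K.
  apply: summable_le cK => m; rewrite ler_wpM2l ?cmod_ge0 //.
  apply: lerXn2r; rewrite ?nnegrE ?divr_ge0 //.
  by rewrite ler_pdivrMr // ler_peMr // ler1n.
have cA := psum_cvg zr' (summable_euler (inl i) rho0 cK).
have cB := psum_cvg zr' (summable_euler (inr i) rho0 cK).
have cf := psum_cvg zr' cK'.
have key t : `|t| <= s ->
    cmod (mixed_eval c (shift z i xi t) - mixed_eval c z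
      - t%:C * (zeta * A + conjc zeta * B)) <= t ^+ 2 * (K / s ^+ 2).
  move=> ts.
  have shr x : cmod (mixed_point (shift z i xi t) x) <= rho.
    have : cmod (shift z i xi t 0 match x with inl k => k | inr k => k end) <= rho.
      set k := (X in shift _ _ _ _ _ X); rewrite /shift !mxE eqxx /=.
      apply: (le_trans (cmodD _ _)).
      rewrite cmodM cmod_real cmodM xi1 mul1r.
      case: eqP => [->|_]; last by rewrite cmod0 mulr0 addr0; have := zr k; lra.
      by rewrite cmod1 mulr1; move: (zr i) ts; rewrite -/s; lra.
    by rewrite mixed_point_cmod; case: x.
  have cft := psum_cvg shr cK.
  apply: (ccvg_norm_le (ccvgD (ccvgD cft (ccvgN cf)) (ccvgN (ccvgM (ccvg_cst t%:C)
    (ccvgD (ccvgM (ccvg_cst zeta) cA) (ccvgM (ccvg_cst (conjc zeta)) cB)))))).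
  near=> N.
  rewrite !psum_uptoE !mulr_sumr -big_split /= mulr_sumr -!sumrN -!big_split /=.
  apply: (le_trans (cmod_sum _ _ _)).
  have -> : t ^+ 2 * (K / s ^+ 2) = (`|t| / s) ^+ 2 * K.
    by rewrite expr_div_n real_normK ?num_real //; ring.
  apply: (@le_trans _ _ (\sum_(m <- box _ N)
      (`|t| / s) ^+ 2 * (cmod (c m) * rho ^+ mdeg m))); last first.
    by rewrite -mulr_sumr ler_wpM2l ?sqr_ge0 //; apply: cK; exact: box_uniq.
  apply: ler_sum => m _; rewrite mono_shift // -/zeta.
  set y1 := t%:C * zeta; set y2 := t%:C * conjc zeta.
  set a := m (inl i); set b := m (inr i); set P := mono (mixed_point z) m.
  rewrite (_ : _ + _ + _ = c m * P *
    ((1 + y1) ^+ a * (1 + y2) ^+ b - 1 - (a%:R * y1 + b%:R * y2))); last first.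
    rewrite /euler -/a -/b /y1 /y2.
    exact: remainder_identity.
  have y1s : cmod y1 = `|t| / s by rewrite cmodM cmod_real nzeta.
  have y2s : cmod y2 = `|t| / s by rewrite cmodM cmod_real cmodJ nzeta.
  rewrite 2!cmodM [leRHS]mulrCA -mulrA ler_wpM2l ?cmod_ge0 //.
  have -> : (`|t| / s) ^+ 2 * rho ^+ mdeg m =
      (rho / 2) ^+ mdeg m * ((`|t| / s) ^+ 2 * 2 ^+ mdeg m).
    by rewrite mulrCA -exprMn divfK ?pnatr_eq0.
  apply: ler_pM; rewrite ?cmod_ge0 ?mono_le //.
  apply: (@le_trans _ _ ((`|t| / s) ^+ 2 * 2 ^+ (a + b))).
    apply: expand_estimate; rewrite ?y1s ?y2s //.
    by rewrite divr_ge0 ?(ltW s0) //= ler_pdivrMr // mul1r.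
  rewrite ler_wpM2l ?sqr_ge0 // ler_weXn2l ?ler1n //.
  by rewrite /mdeg (bigD1 (inl i)) //= (bigD1 (inr i)) //= addnA leq_addr.
rewrite /dir_deriv.
have shE t : z + t%:C *: (xi *: delta_mx 0 i) = shift z i xi t by [].
have sh0 : shift z i xi 0 = z by rewrite /shift rmorph0 scale0r addr0.
have ReZ (t : R) (x : R[i]) : complex.Re (t%:C * x) = t * complex.Re x.
  by rewrite ReM /= mul0r subr0.
have ImZ (t : R) (x : R[i]) : complex.Im (t%:C * x) = t * complex.Im x.
  by rewrite ImM /= mul0r addr0.
apply: complexP => /=.
  apply: (derive1_quadratic s0) => t ts; rewrite !shE sh0.
  rewrite -ReZ -!ReN -!ReD; exact: le_trans (Re_le_cmod _) (key t ts).
apply: (derive1_quadratic s0) => t ts; rewrite !shE sh0.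
rewrite -ImZ -!ImN -!ImD; exact: le_trans (Im_le_cmod _) (key t ts).
Unshelve. all: by end_near. Qed.

(* Here [j] stands for the imaginary unit, [x] for [z_i] and [y] for its
   conjugate. *)
Lemma wirtinger_algebra (j A B x y : R[i]) : j * j = -1 -> x != 0 -> y != 0 ->
  x * ((1 / x * A + 1 / y * B - j * (j / x * A + - j / y * B)) / 2%:R) = A /\
  y * ((1 / x * A + 1 / y * B + j * (j / x * A + - j / y * B)) / 2%:R) = B.
Proof.
move=> jj x0 y0; have two0 : 2%:R != 0 :> R[i] by rewrite pnatr_eq0.
split.
  rewrite (_ : 1 / x * A + 1 * y^-1 * B - j * (j / x * A + - j * y^-1 * B) =
    (1 - j * j) * (A / x) + (1 + j * j) * (B / y)); last by ring.
  by rewrite jj subrr mul0r addr0; field; rewrite x0.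
rewrite (_ : 1 / x * A + 1 * y^-1 * B + j * (j / x * A + - j * y^-1 * B) =
    (1 + j * j) * (A / x) + (1 - j * j) * (B / y)); last by ring.
by rewrite jj subrr mul0r add0r; field; rewrite y0.
Qed.

(** The Wirtinger derivatives of a mixed series, in logarithmic form: they are
    given by Euler operators. *)
Lemma dz_mixed_eval c (rho K : R) z i :
  summable_at c rho K -> (forall k, cmod (z 0 k) <= rho / 2) -> z 0 i != 0 ->
  z 0 i * dz (mixed_eval c) i z = psum (euler (inl i) c) (mixed_point z) /\
  conjc (z 0 i) * dzbar (mixed_eval c) i z = psum (euler (inr i) c) (mixed_point z).
Proof.
move=> cK zr zi0.
have px := dir_deriv_mixed_eval cK zr zi0 (cmod1 R).
rewrite scale1r in px.
have i1 : cmod ('i%C : R[i]) = 1 by rewrite cmodE /= expr0n expr1n add0r sqrtr1.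
have py := dir_deriv_mixed_eval cK zr zi0 i1.
have ii : 'i%C * 'i%C = -1 :> R[i] by apply: complexP => /=; rewrite ?mul0r ?mulr0; ring.
have ci : conjc 'i%C = - 'i%C :> R[i] by apply: complexP => /=; rewrite ?oppr0.
rewrite /dz /dzbar /pdx /pdy px py !conjM conjc1 ci !conjc_inv.
have cz0 : conjc (z 0 i) != 0 by rewrite conjc_eq0.
exact: wirtinger_algebra ii zi0 cz0.
Qed.

End LogDerivatives.

(** * Critical points and covectors *)

Lemma conj_imaginary (R : realType) (X Y : R[i]) :
  complex.Re X = 0 -> complex.Re Y = 0 ->
  (X + 'i%C * Y) / 2%:R = - conjc ((X - 'i%C * Y) / 2%:R).
Proof.
move=> X0 Y0; rewrite conjM conjc_inv conjc_nat -mulNr; congr (_ / _).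
case: X Y X0 Y0 => [a b] [a' b'] /= -> ->.
by apply: complexP => /=; ring.
Qed.

(** The covector [a] annihilates the real differential of [G] at [z], in terms of
    the Wirtinger derivatives. *)
Definition covector_at (R : realType) (n k : nat) (G : 'I_k -> 'rV[R[i]]_n -> R[i])
    (z : 'rV[R[i]]_n) (a : 'rV[R[i]]_k) : Prop :=
  forall i : 'I_n, \sum_j a 0 j * dzbar (G j) i z =
    - \sum_j conjc (a 0 j) * conjc (dz (G j) i z).

(** If [(p, q)] is in the left kernel of the real Jacobian matrix, then the
    covector [p - i q] annihilates the Wirtinger gradients. *)
Lemma critical_covector (R : realType) (n k : nat)
    (G : 'I_k -> 'rV[R[i]]_n -> R[i]) z :
  critical_set G z ->
  exists2 a : 'rV[R[i]]_k, a != 0 & covector_at G z a.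
Proof.
rewrite /critical_set /=; set J := real_jacobian G z => rkJ.
pose v := nz_row (kermx J).
have v0 : v != 0.
  by rewrite nz_row_eq0 kermx_eq0 /row_free neq_ltn rkJ.
have vJ : v *m J = 0 by apply/sub_kermxP; exact: nz_row_sub.
have [p [q vE]] : exists p q : 'rV[R]_k, v = row_mx p q.
  by exists (lsubmx v), (rsubmx v); rewrite hsubmxK.
move: vJ; rewrite vE /J mul_row_block -row_mx0 => /eq_row_mx[/rowP Hx /rowP Hy].
exists (\row_j (p 0 j -i* q 0 j)).
  apply: contra v0 => /eqP /rowP a0; rewrite vE.
  have pq j : p 0 j = 0 /\ q 0 j = 0.
    by have := a0 j; rewrite !mxE => -[-> /eqP]; rewrite oppr_eq0 => /eqP.
  apply/eqP; rewrite -row_mx0; congr row_mx; apply/rowP => j.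
    by rewrite (pq j).1 mxE.
  by rewrite (pq j).2 mxE.
move=> i.
under eq_bigr do rewrite mxE.
under [in RHS]eq_bigr do rewrite mxE.
pose X := \sum_j (p 0 j -i* q 0 j) * pdx (G j) i z.
pose Y := \sum_j (p 0 j -i* q 0 j) * pdy (G j) i z.
have X0 : complex.Re X = 0.
  have := Hx i; rewrite !mxE -big_split /= => <-; rewrite /X Re_sum.
  by apply: eq_bigr => j _; rewrite !mxE ReM /= mulNr opprK.
have Y0 : complex.Re Y = 0.
  have := Hy i; rewrite !mxE -big_split /= => <-; rewrite /Y Re_sum.
  by apply: eq_bigr => j _; rewrite !mxE ReM /= mulNr opprK.
have conjcD_sum (I : Type) (r : seq I) (f : I -> R[i]) :
    conjc (\sum_(j <- r) f j) = \sum_(j <- r) conjc (f j).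
  by apply: big_morph; [exact: conjD | exact: conjc0].
have -> : \sum_j (p 0 j -i* q 0 j) * dzbar (G j) i z = (X + 'i%C * Y) / 2%:R.
  rewrite /X /Y mulr_sumr -big_split /= mulr_suml; apply: eq_bigr => j _.
  by rewrite /dzbar; ring.
have -> : \sum_j conjc (p 0 j -i* q 0 j) * conjc (dz (G j) i z) =
    conjc ((X - 'i%C * Y) / 2%:R).
  under eq_bigr do rewrite -conjM.
  rewrite -conjcD_sum; congr conjc.
  rewrite /X /Y mulr_sumr -sumrB mulr_suml; apply: eq_bigr => j _.
  by rewrite /dz; ring.
exact (conj_imaginary X0 Y0).
Qed.

(** * Orders of magnitude along an ultrafilter *)

Section Tropical.
Variables (R : realType) (n : nat) (U : set_system 'rV[R[i]]_n).
Context {UU : UltraFilter U}.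
(* [U] converges to the origin. *)
Hypothesis U0 : forall e : R, 0 < e ->
  \forall z \near U, forall i, cmod ((z : 'rV[R[i]]_n) 0 i) < e.
Local Notation midx := {ffun 'I_n + 'I_n -> nat}.
Implicit Types (m e : midx) (d : 'rV[rat]_n).

(** The coordinates that do not vanish along [U]. *)
Definition usupp : {set 'I_n} :=
  [set i | `[< \forall z \near U, (z : 'rV[R[i]]_n) 0 i != 0 >]].

Lemma near_usupp :
  \forall z \near U, forall i, ((z : 'rV[R[i]]_n) 0 i != 0) = (i \in usupp).
Proof.
apply: filter_forall => i; rewrite inE.
case: asboolP => [|/ultraNot]; first exact.
by apply: filterS => z /negP; rewrite negbK => ->.
Qed.

(** Multi-indices of the monomials that do not vanish along [U]. *)
Definition supported m : bool :=
  [forall i, (i \notin usupp) ==> (m (inl i) == 0%N) && (m (inr i) == 0%N)].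

Lemma supportedP m : reflect
  (forall i, i \notin usupp -> m (inl i) = 0%N /\ m (inr i) = 0%N) (supported m).
Proof.
apply: (iffP forallP) => [H i iI|H i].
  by have := H i; rewrite iI /= => /andP[/eqP -> /eqP ->].
by apply/implyP => /H[-> ->].
Qed.

Lemma mono_mixed_eq0 (z : 'rV[R[i]]_n) m i : z 0 i = 0 ->
  mono (mixed_point z) m != 0 -> m (inl i) = 0%N /\ m (inr i) = 0%N.
Proof.
move=> zi0 /prodf_neq0 H; split.
  by have := H (inl i) isT; rewrite /= zi0 expf_eq0 eqxx andbT lt0n negbK => /eqP.
by have := H (inr i) isT; rewrite /= zi0 conjc0 expf_eq0 eqxx andbT lt0n negbK => /eqP.
Qed.

Lemma cmod_mono_mixed (z : 'rV[R[i]]_n) m :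
  cmod (mono (mixed_point z) m) = \prod_i cmod (z 0 i) ^+ (m (inl i) + m (inr i)).
Proof.
rewrite cmod_mono big_sumType /= -big_split /=; apply: eq_bigr => i _.
by rewrite cmodJ exprD.
Qed.

(** The exponent vector of the modulus of a monomial. *)
Definition expvec m : 'rV[rat]_n := \row_i (m (inl i) + m (inr i))%:R.

(** The linear form with coefficients [d] in the variables [- ln |z_i|]. *)
Definition lform d (z : 'rV[R[i]]_n) : R :=
  \sum_i ratr (d 0 i) * - ln (cmod (z 0 i)).

Lemma lformD d d' z : lform (d + d') z = lform d z + lform d' z.
Proof.
by rewrite /lform -big_split /=; apply: eq_bigr => i _; rewrite mxE rmorphD mulrDl.
Qed.

Lemma lformZ a d z : lform (a *: d) z = ratr a * lform d z.
Proof.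
by rewrite /lform mulr_sumr; apply: eq_bigr => i _; rewrite mxE rmorphM mulrA.
Qed.

Lemma lformB d d' z : lform (d - d') z = lform d z - lform d' z.
Proof. by rewrite lformD -[- d']scaleN1r lformZ rmorphN1 mulN1r. Qed.

Lemma mono_supported_gt0 : \forall z \near U, forall m, supported m ->
  0 < cmod (mono (mixed_point z) m).
Proof.
apply: filterS near_usupp => z zI m /supportedP mI.
rewrite cmod_mono_mixed; apply: prodr_gt0 => i _.
case: (boolP (i \in usupp)) => [|/mI[-> ->]]; last by rewrite expr0.
by rewrite -zI => zi; rewrite exprn_gt0 // cmod_gt0.
Qed.

Lemma mono_ratio : \forall z \near U, forall m e, supported m -> supported e ->
  cmod (mono (mixed_point z) m) / cmod (mono (mixed_point z) e) =
  expR (- lform (expvec m - expvec e) z).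
Proof.
apply: filterS near_usupp => z zI.
have E m : supported m -> cmod (mono (mixed_point z) m) = expR (- lform (expvec m) z).
  move=> /supportedP mI; rewrite cmod_mono_mixed /lform -sumrN expR_sum.
  apply: eq_bigr => i _; rewrite mxE ratr_nat mulrN opprK.
  case: (boolP (i \in usupp)) => [|/mI[-> ->]]; last by rewrite mul0r expR0.
  rewrite -zI -cmod_gt0 => zi.
  by rewrite expRM_natl lnK // posrE.
by move=> m e mI eI; rewrite !E // lformB -expRN -expRD opprD.
Qed.

(** The linear forms that tend to [+oo] along [U], and those that stay bounded.
    A form that is eventually nonnegative is of one of these kinds. *)
Definition upos d : Prop := forall M : R, \forall z \near U, M <= lform d z.
Definition ubdd d : Prop := exists M : R, \forall z \near U, `|lform d z| <= M.

Lemma upos_or_ubdd d : (\forall z \near U, 0 <= lform d z) -> upos d \/ ubdd d.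
Proof.
move=> d0; have [[M HM]|nM] := pselect (exists M, \forall z \near U, lform d z <= M).
  by right; exists M; apply: filterS2 d0 HM => z z0 zM; rewrite ger0_norm.
left => M; have /ultraNot : ~ (\forall z \near U, lform d z <= M).
  by move=> H; apply: nM; exists M.
by apply: filterS => z /negP; rewrite -ltNge => /ltW.
Qed.

Lemma upos_unit i : i \in usupp -> upos (delta_mx 0 i).
Proof.
move=> iI M; have e0 : 0 < expR (- M) :> R by exact: expR_gt0.
apply: filterS2 near_usupp (U0 e0) => z zI zM.
rewrite /lform (bigD1 i) //= big1 ?addr0; last first.
  by move=> j ji; rewrite mxE (negbTE ji) andbF rmorph0 mul0r.
rewrite mxE !eqxx rmorph1 mul1r lerNr -[leRHS]expRK ler_ln ?posrE ?expR_gt0 //.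
  exact: ltW.
by rewrite cmod_gt0 zI.
Qed.

(** Modulo bounded functions, the functions [- ln |z_i|] generate a vector space
    ordered by their behaviour along [U], to which elimination applies. *)
Lemma ultra_fourier_motzkin (L E : seq 'rV[rat]_n) :
  (forall d, d \in L -> upos d) -> (forall d, d \in E -> ubdd d) ->
  exists P : 'cV[rat]_n,
    (forall d, d \in L -> 0 < (d *m P) 0 0) /\
    (forall d, d \in E -> (d *m P) 0 0 = 0).
Proof.
apply: fourier_motzkin.
- move=> d e pd pe M; apply: filterS2 (pd M) (pe 0) => z.
  by rewrite lformD; lra.
- move=> a d a0 pd M; apply: filterS (pd (M / ratr a)) => z.
  by rewrite lformZ ler_pdivrMr ?ltr0q // mulrC.
- move=> a d e pd [B HB] M; apply: filterS2 (pd (M + `|ratr a| * B)) HB => z dz eB.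
  rewrite lformD lformZ.
  have : `|ratr a * lform e z| <= `|ratr a| * B by rewrite normrM ler_wpM2l.
  by rewrite ler_norml; lra.
- move=> a d e [A HA] [B HB]; exists (A + `|ratr a| * B).
  apply: filterS2 HA HB => z dA eB; rewrite lformD lformZ.
  by apply: (le_trans (ler_normD _ _)); rewrite lerD // normrM ler_wpM2l.
- move=> /(_ 1) /filter_ex[z]; rewrite /lform big1; first by rewrite ler10.
  by move=> i _; rewrite mxE rmorph0 mul0r.
Qed.

(** Forms that are bounded along [U] have limits there, and these limits are the
    values of the forms at a real point, because the image of a linear map is
    closed. *)
Lemma ultra_real_point (E : seq 'rV[rat]_n) : (forall d, d \in E -> ubdd d) ->
  exists l : 'I_n -> R, forall d, d \in E ->
    lform d z @[z --> U] --> \sum_i ratr (d 0 i) * l i.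
Proof.
move=> EB.
pose D : 'M[R]_(n, size E) := \matrix_(i, j) ratr (nth 0 E j 0 i).
pose v (z : 'rV[R[i]]_n) : 'rV[R]_n := \row_i - ln (cmod (z 0 i)).
have vE z j : (v z *m D) 0 j = lform (nth 0 E j) z.
  by rewrite mxE; apply: eq_bigr => i _; rewrite !mxE mulrC.
have lim_ex (j : 'I_(size E)) : exists x : R, (v z *m D) 0 j @[z --> U] --> x.
  have [M HM] := EB _ (mem_nth 0 (ltn_ord j)).
  by apply: (@ultra_bounded_cvg _ _ _ _ _ M); apply: filterS HM => z; rewrite vE.
have [c Hc] := boolp.choice lim_ex.
pose crow : 'rV[R]_(size E) := \row_j c j.
have cD : crow *m pinvmx D *m D = crow.
  apply/rowP => j; rewrite -mulmxA.
  have H1 : (v z *m D *m (pinvmx D *m D)) 0 j @[z --> U] -->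
      (crow *m (pinvmx D *m D)) 0 j.
    rewrite [X in _ --> X]mxE; under eq_fun do rewrite mxE.
    apply: cvg_big => [|k _]; first by move=> ? ?; exact: add_continuous.
    by apply: cvgM; [rewrite mxE; exact: Hc | exact: cvg_cst].
  have H2 : (v z *m D *m (pinvmx D *m D)) 0 j @[z --> U] --> crow 0 j.
    rewrite mxE; under eq_fun do rewrite mulmxA mulmxKpV ?submxMl //.
    exact: Hc.
  exact: (cvg_unique _ H1 H2).
exists (fun i => (crow *m pinvmx D) 0 i) => d dE.
have jE : (index d E < size E)%N by rewrite index_mem.
have := Hc (Ordinal jE); under eq_fun do rewrite vE /= nth_index //.
suff -> : \sum_i ratr (d 0 i) * (crow *m pinvmx D) 0 i = c (Ordinal jE) by [].
have : (crow *m pinvmx D *m D) 0 (Ordinal jE) = c (Ordinal jE) by rewrite cD mxE.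
move=> <-; rewrite [RHS]mxE; apply: eq_bigr => i _.
by rewrite [D _ _]mxE /= nth_index // mulrC.
Qed.

Lemma ultra_largest (f : midx -> 'rV[R[i]]_n -> R) (s : seq midx) (m : midx) :
  exists2 m0, m0 \in m :: s &
    forall e, e \in m :: s -> \forall z \near U, f e z <= f m0 z.
Proof.
elim: s m => [|m' s IH] m.
  exists m => [|e]; rewrite inE // => /eqP ->; exact: nearW.
have [m0 m0s Hm0] := IH m'.
have [le|/ultraNot le] := pselect (\forall z \near U, f m z <= f m0 z).
  by exists m0 => [|e]; rewrite inE ?m0s ?orbT // => /orP[/eqP ->|/Hm0].
exists m => [|e]; rewrite inE ?eqxx // => /orP[/eqP ->|/Hm0 em0]; first exact: nearW.
by apply: filterS2 em0 le => z em /negP; rewrite -ltNge => /ltW; exact: le_trans.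
Qed.

Lemma ultra_ccvg (f : 'rV[R[i]]_n -> R[i]) (M : R) :
  (\forall z \near U, cmod (f z) <= M) -> exists l, ccvg U f l.
Proof.
move=> fM.
have [|a Ha] := @ultra_bounded_cvg _ _ U _ (fun z => complex.Re (f z)) M.
  by apply: filterS fM => z; apply: le_trans; exact: Re_le_cmod.
have [|b Hb] := @ultra_bounded_cvg _ _ U _ (fun z => complex.Im (f z)) M.
  by apply: filterS fM => z; apply: le_trans; exact: Im_le_cmod.
by exists (a +i* b).
Qed.

End Tropical.

(** * Leading terms, weights and points of the torus *)

Section LeadingTerms.
Variables (R : realType) (n : nat) (U : set_system 'rV[R[i]]_n).
Context {UU : UltraFilter U}.
(* [U] converges to the origin. *)
Hypothesis U0 : forall e : R, 0 < e ->
  \forall z \near U, forall i, cmod ((z : 'rV[R[i]]_n) 0 i) < e.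
Local Notation midx := {ffun 'I_n + 'I_n -> nat}.
Implicit Types (m e : midx) (c : mixed_series R n) (z : 'rV[R[i]]_n).

(** [E] is a finite set of terms of [c] such that, along [U], every term of [c]
    that does not vanish is divisible by a monomial from [E], and the monomial
    [m0] from [E] dominates the other ones. *)
Record leading_basis c (E : seq midx) (m0 : midx) : Prop := LeadingBasis {
  lb_uniq : uniq E;
  lb_term : forall e, e \in E -> c e != 0 /\ supported U e;
  lb_dom : forall m, c m != 0 -> supported U m ->
    exists2 e, e \in E & forall x, (e x <= m x)%N;
  lb_mem : m0 \in E;
  lb_max : forall e, e \in E -> \forall z \near U,
    cmod (mono (mixed_point z) e) <= cmod (mono (mixed_point z) m0)
}.

Lemma leading_basis_exists c : (exists2 m, c m != 0 & supported U m) ->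
  exists E m0, leading_basis c E m0.
Proof.
move=> [m cm mU].
have [E [ES Edom]] := dickson (fun m => c m != 0 /\ supported U m).
have [e eE _] := Edom _ (conj cm mU).
have : undup E != [::] by case: (undup E) (mem_undup E e); rewrite ?eE.
case EE : (undup E) => [//|e0 s] _.
have [m0 m0s Hm0] := ultra_largest (fun m z => cmod (mono (mixed_point z) m)) s e0.
exists (undup E), m0; split=> [|e'|m' cm' m'U||e' e'E].
- exact: undup_uniq.
- by rewrite mem_undup => /ES.
- by have [e' e'E] := Edom _ (conj cm' m'U); exists e' => //; rewrite mem_undup.
- by rewrite EE.
- by apply: Hm0; rewrite -EE.
Qed.

(** The leading terms: those from [E] of the same size as [m0] along [U], up to
    bounded factors. *)
Definition leading (E : seq midx) (m0 m : midx) : bool :=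
  (m \in E) && `[< ubdd U (expvec m - expvec m0) >].

Lemma not_leading c E m0 e : leading_basis c E m0 -> e \in E ->
  ~~ leading E m0 e -> upos U (expvec e - expvec m0).
Proof.
move=> lb eE; rewrite /leading eE /= => /asboolPn nb.
suff d0 : \forall z \near U, 0 <= lform (expvec e - expvec m0) z.
  by case: (upos_or_ubdd d0).
have [_ eU] := lb_term lb eE; have [_ mU] := lb_term lb (lb_mem lb).
apply: filterS3 (lb_max lb eE) (@mono_ratio _ _ U _) (@mono_supported_gt0 _ _ U _)
  => z le rat gt0.
have := rat e m0 eU mU; have := gt0 m0 mU => m0gt.
have : cmod (mono (mixed_point z) e) / cmod (mono (mixed_point z) m0) <= 1.
  by rewrite ler_pdivrMr // mul1r.
by move=> le1 ratE; move: le1; rewrite ratE -[leRHS]expR0 ler_expR oppr_le0.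
Qed.

Lemma weight_expvec (P : 'I_n -> nat) m :
  (weight P m)%:R = (expvec m *m \col_i (P i)%:R) 0 0 :> rat.
Proof.
rewrite /weight natr_sum mxE; apply: eq_bigr => i _.
by rewrite natrM !mxE mulrC.
Qed.

Lemma eq_weight (P Q : 'I_n -> nat) m :
  (forall i, i \in usupp U -> P i = Q i) -> supported U m -> weight P m = weight Q m.
Proof.
move=> PQ /supportedP mU; apply: eq_bigr => i _.
by case: (boolP (i \in usupp U)) => [/PQ ->|/mU[-> ->]]; rewrite ?muln0.
Qed.

(** A positive integral weight whose faces consist of the leading terms.  Their
    exponent differences give the equations, those of the other terms from the
    bases give the strict inequalities. *)
Lemma leading_weight (k : nat) (c : 'I_k -> mixed_series R n)
    (E : 'I_k -> seq midx) (m0 : 'I_k -> midx) :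
  (forall j, leading_basis (c j) (E j) (m0 j)) ->
  exists P : 'I_n -> nat, (forall i, (0 < P i)%N) /\
    forall j m, face_series P (c j) m = if leading (E j) (m0 j) m then c j m else 0.
Proof.
move=> lb.
pose df j e : 'rV[rat]_n := expvec e - expvec (m0 j).
pose un i : 'rV[rat]_n := delta_mx 0 i.
pose L : seq 'rV[rat]_n := [seq un i | i <- enum (usupp U)] ++
  [seq df j e | j <- enum 'I_k, e <- [seq e <- E j | ~~ leading (E j) (m0 j) e]].
pose D : seq 'rV[rat]_n :=
  [seq df j e | j <- enum 'I_k, e <- [seq e <- E j | leading (E j) (m0 j) e]].
have [||P0 [HL HD]] := @ultra_fourier_motzkin _ _ U _ L D.
- move=> d; rewrite mem_cat => /orP[/mapP[l]|/allpairsPdep[j [e [_]]]].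
    by rewrite mem_enum => lU ->; exact: upos_unit.
  by rewrite mem_filter => /andP[nl eE] ->; exact: not_leading (lb j) eE nl.
- move=> d /allpairsPdep[j [e [_]]]; rewrite mem_filter => /andP[/andP[_ /asboolP]].
  by move=> H _ ->.
pose P1 : 'cV[rat]_n := \col_i if i \in usupp U then P0 i 0 else 1.
have [|Q [N N0 QE]] := @clear_denominators _ P1.
  move=> i; rewrite mxE; case: ifP => // iU.
  have : un i \in L by rewrite mem_cat map_f // mem_enum.
  by move=> /HL; rewrite -rowE mxE.
(* Outside the support the weights exceed the weights of all leading terms. *)
pose B := (\sum_j weight Q (m0 j)).+1.
pose P i := if i \in usupp U then Q i else B.
have PQ m : supported U m -> weight P m = weight Q m.
  by apply: eq_weight => i iU; rewrite /P iU.
have wdiff j e : supported U e ->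
    (weight Q e)%:R - (weight Q (m0 j))%:R = N * (df j e *m P0) 0 0.
  move=> /supportedP eU; have [_ /supportedP mU] := lb_term (lb j) (lb_mem (lb j)).
  rewrite !weight_expvec [_ - _](_ : _ = (df j e *m \col_i (Q i)%:R) 0 0); last first.
    by rewrite /df mulmxBl [RHS]mxE [X in _ = _ + X]mxE.
  rewrite !mxE mulr_sumr; apply: eq_bigr => i _.
  rewrite [X in _ * X = _]mxE QE [P1 i 0]mxE.
  case: ifP => [_|/negbT iU]; first by ring.
  have [e1 e2] := eU i iU; have [m1 m2] := mU i iU.
  by rewrite /df !mxE e1 e2 m1 m2 subrr !mul0r mulr0.
have w_lead j e : leading (E j) (m0 j) e -> weight P e = weight P (m0 j).
  move=> le; have /andP[eE _] := le.
  have [_ eU] := lb_term (lb j) eE; have [_ mU] := lb_term (lb j) (lb_mem (lb j)).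
  rewrite !PQ //; apply/eqP; rewrite -(eqr_nat rat) -subr_eq0 wdiff // HD ?mulr0 //.
  by apply/allpairsPdep; exists j, e; rewrite mem_enum mem_filter le.
have w_nlead j e : e \in E j -> ~~ leading (E j) (m0 j) e ->
    (weight P (m0 j) < weight P e)%N.
  move=> eE le.
  have [_ eU] := lb_term (lb j) eE; have [_ mU] := lb_term (lb j) (lb_mem (lb j)).
  rewrite !PQ // -(ltr_nat rat) -subr_gt0 wdiff // mulr_gt0 // HL //.
  rewrite mem_cat; apply/orP; right.
  by apply/allpairsPdep; exists j, e; rewrite mem_enum mem_filter le.
have Ppos i : (0 < P i)%N.
  rewrite /P; case: ifP => // iU.
  by rewrite -(ltr_nat rat) QE mulr_gt0 // mxE iU;
     have := HL (un i); rewrite -rowE mxE; apply; rewrite mem_cat map_f // mem_enum.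
have w_nsupp j m : ~~ supported U m -> (weight P (m0 j) < weight P m)%N.
  have [_ mU] := lb_term (lb j) (lb_mem (lb j)).
  rewrite negb_forall => /existsP[l]; rewrite negb_imply => /andP[lU ml].
  apply: (@leq_trans B).
    by rewrite PQ // ltnS (bigD1 j) //= leq_addr.
  rewrite /weight (bigD1 l) //= /P (negbTE lU).
  apply: leq_trans (leq_addr _ _); rewrite leq_pmulr // addn_gt0 !lt0n -negb_and.
  exact: ml.
have w_min j e : e \in E j -> (weight P (m0 j) <= weight P e)%N.
  move=> eE; case: (boolP (leading (E j) (m0 j) e)) => [/w_lead ->//|le].
  exact: ltnW (w_nlead _ _ eE le).
have w_new j m : c j m != 0 -> m \notin E j -> (weight P (m0 j) < weight P m)%N.
  move=> cm mE; case: (boolP (supported U m)) => [mU|]; last exact: w_nsupp.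
  have [e eE em] := lb_dom (lb j) cm mU.
  apply: leq_ltn_trans (w_min _ _ eE) _.
  have [x xlt] : exists x, (e x < m x)%N.
    apply/existsP; apply: contraR mE => /existsPn H.
    suff -> : m = e by [].
    by apply/ffunP => x; apply/eqP; rewrite eqn_leq em andbT leqNgt H.
  pose i := match x with inl i => i | inr i => i end.
  rewrite /weight (bigD1 i) //= [ltnRHS](bigD1 i) //= -addSn leq_add //.
    rewrite ltn_pmul2l //.
    move: xlt; rewrite /i; case: (x) => l xl.
      by rewrite -addSn leq_add ?em.
    by rewrite -addnS leq_add ?em.
  by apply: leq_sum => l _; rewrite leq_mul2l leq_add ?orbT ?em.
exists P; split=> // j m; rewrite /face_series.
have m0c : c j (m0 j) != 0 by have [] := lb_term (lb j) (lb_mem (lb j)).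
case: (boolP (leading (E j) (m0 j) m)) => [lm|nlm].
  case: asboolP => // -[] m' cm'; rewrite (w_lead j) //.
  by case: (boolP (m' \in E j)) => [/w_min//|/(w_new _ _ cm')/ltnW].
case: asboolP => // /(_ _ m0c); have [->//|cm] := eqVneq (c j m) 0.
by case: (boolP (m \in E j)) => [/w_nlead/(_ nlm)|/(w_new _ _ cm)];
  rewrite ltnNge => /negbTE ->.
Qed.

(** The vector of the directions [z_i / |z_i|], with 0 where [z_i = 0]. *)
Definition dirvec z : 'rV[R[i]]_n := \row_i (z 0 i / (cmod (z 0 i))%:C).

Lemma mono_dirvec z m : mono (mixed_point z) m =
  (cmod (mono (mixed_point z) m))%:C * mono (mixed_point (dirvec z)) m.
Proof.
have E x : mixed_point z x = (cmod (mixed_point z x))%:C * mixed_point (dirvec z) x.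
  have zE i : z 0 i = (cmod (z 0 i))%:C * dirvec z 0 i.
    rewrite mxE; have [->|zi] := eqVneq (z 0 i) 0; first by rewrite cmod0 mul0r.
    rewrite mulrCA divff ?mulr1 //.
    by apply: contra zi => /eqP[/eqP]; rewrite cmod_eq0.
  case: x => i /=; first exact: zE.
  by rewrite cmodJ {1}zE conjM conjc_real.
rewrite cmod_mono rmorph_prod /mono -big_split /=; apply: eq_bigr => x _.
by rewrite {1}E exprMn rmorphXn.
Qed.

(** A point of the torus at which the ratios of the leading terms are the limits
    of their ratios along [U].  Its moduli come from [ultra_real_point], its
    arguments are limits of arguments, and the coordinates that vanish along [U]
    are replaced by 1. *)
Lemma leading_point (k : nat) (c : 'I_k -> mixed_series R n)
    (E : 'I_k -> seq midx) (m0 : 'I_k -> midx) :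
  (forall j, leading_basis (c j) (E j) (m0 j)) ->
  exists a : 'rV[R[i]]_n, (forall i, a 0 i != 0) /\
    forall j e, leading (E j) (m0 j) e ->
    ccvg U (fun z => mono (mixed_point z) e / (cmod (mono (mixed_point z) (m0 j)))%:C)
           (mono (mixed_point a) e / (cmod (mono (mixed_point a) (m0 j)))%:C).
Proof.
move=> lb.
pose df j e : 'rV[rat]_n := expvec e - expvec (m0 j).
pose D : seq 'rV[rat]_n :=
  [seq df j e | j <- enum 'I_k, e <- [seq e <- E j | leading (E j) (m0 j) e]].
have [|l Hl] := @ultra_real_point _ _ U _ D.
  move=> d /allpairsPdep[j [e [_]]]; rewrite mem_filter => /andP[/andP[_ /asboolP]].
  by move=> H _ ->.
have dir_ex i : exists t, ccvg U (fun z => dirvec z 0 i) t.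
  apply: (@ultra_ccvg _ _ U _ _ 1); apply: nearW => z.
  rewrite mxE cmodM cmodV cmod_real ger0_norm ?cmod_ge0 //.
  have [->|zi] := eqVneq (z 0 i) 0; first by rewrite cmod0 mul0r.
  by rewrite divff // cmod_eq0.
have [t Ht] := boolp.choice dir_ex.
have t1 i : i \in usupp U -> cmod (t i) = 1.
  move=> iU; have H := ccvg_norm (Ht i).
  suff H1 : cmod (dirvec z 0 i) @[z --> U] --> (1 : R) by exact: (cvg_unique _ (H _) H1).
  have c1 : (fun=> 1 : R) z @[z --> U] --> (1 : R) by exact: cvg_cst.
  apply: cvg_trans c1; apply: near_eq_cvg.
  apply: filterS (@near_usupp _ _ U _) => z /(_ i); rewrite iU => zi.
  by rewrite /dirvec mxE cmodM cmodV cmod_real ger0_norm ?cmod_ge0 // divff // cmod_eq0.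
pose a : 'rV[R[i]]_n := \row_i if i \in usupp U then (expR (- l i))%:C * t i else 1.
have aE i : i \in usupp U -> cmod (a 0 i) = expR (- l i).
  by move=> iU; rewrite mxE iU cmodM t1 // mulr1 cmod_real ger0_norm ?expR_ge0.
have a0 i : a 0 i != 0.
  rewrite -cmod_gt0; case: (boolP (i \in usupp U)) => [/aE ->|iU]; first exact: expR_gt0.
  by rewrite mxE (negbTE iU) cmod1.
have dirt z' e : supported U e -> (forall i, i \in usupp U -> dirvec z' 0 i = t i) ->
    mono (mixed_point (dirvec z')) e = mono (mixed_point (\row_i t i)) e.
  move=> /supportedP eU z't; apply: eq_bigr => -[] i _ /=.
    by case: (boolP (i \in usupp U)) => [/z't ->|/eU[-> _]]; rewrite ?mxE.
  by case: (boolP (i \in usupp U)) => [/z't ->|/eU[_ ->]]; rewrite ?mxE.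
exists a; split=> // j e le; have /andP[eE _] := le.
have [_ eU] := lb_term (lb j) eE; have [_ mU] := lb_term (lb j) (lb_mem (lb j)).
have lim_mod : expR (- lform (df j e) z) @[z --> U] -->
    cmod (mono (mixed_point a) e) / cmod (mono (mixed_point a) (m0 j)).
  have -> : cmod (mono (mixed_point a) e) / cmod (mono (mixed_point a) (m0 j)) =
      expR (- \sum_i ratr (df j e 0 i) * l i).
    have aexp m : supported U m -> cmod (mono (mixed_point a) m) =
        expR (- \sum_i ratr (expvec m 0 i) * l i).
      move=> /supportedP mU'; rewrite cmod_mono_mixed -sumrN expR_sum.
      apply: eq_bigr => i _; rewrite [expvec m 0 i]mxE ratr_nat -mulrN.
      case: (boolP (i \in usupp U)) => [iU|/mU'[-> ->]]; last by rewrite mul0r expR0.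
      by rewrite aE // expRM_natl.
    rewrite !aexp // -expRN -expRD; congr expR; apply: oppr_inj.
    rewrite opprD !opprK -sumrB; apply: eq_bigr => i _.
    by rewrite -mulrBl /df -rmorphB; congr (ratr _ * _); rewrite !mxE.
  apply: (@continuous_cvg _ _ _ _ _ _ (@expR R)); first exact: continuous_expR.
  apply: cvgN; apply: Hl; apply/allpairsPdep; exists j, e.
  by rewrite mem_enum mem_filter le.
have lim_dir : ccvg U (fun z => mono (mixed_point (dirvec z)) e)
    (mono (mixed_point (\row_i t i)) e).
  apply: ccvg_prod => -[] i /=; apply: ccvgX; rewrite mxE; first exact: Ht.
  exact: ccvgJ.
have -> : mono (mixed_point a) e / (cmod (mono (mixed_point a) (m0 j)))%:C =
    (cmod (mono (mixed_point a) e) / cmod (mono (mixed_point a) (m0 j)))%:C *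
      mono (mixed_point (\row_i t i)) e.
  rewrite {1}mono_dirvec (dirt a e eU) => [|i iU].
    by rewrite rmorphM fmorphV mulrAC.
  rewrite mxE aE // [a 0 i]mxE iU mulrAC divff ?mul1r //.
  by apply/eqP => -[] /eqP; rewrite gt_eqF ?expR_gt0.
apply: ccvg_near (ccvgM (ccvg_real lim_mod) lim_dir).
apply: filterS (@mono_ratio _ _ U _) => z /(_ e (m0 j) eU mU) <-.
by rewrite [in RHS]mono_dirvec rmorphM fmorphV mulrAC.
Qed.

Lemma upos_ratio_cvg0 e m : supported U e -> supported U m ->
  upos U (expvec e - expvec m) ->
  ccvg U (fun z => mono (mixed_point z) e / (cmod (mono (mixed_point z) m))%:C) 0.
Proof.
move=> eU mU ep.
apply: (@ccvg_squeeze _ _ U _ _ _ (fun z => expR (- lform (expvec e - expvec m) z))).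
  apply: filterS (@mono_ratio _ _ U _) => z /(_ e m eU mU) <-.
  by rewrite subr0 cmodM cmodV cmod_real ger0_norm ?cmod_ge0.
apply/cvgrPdist_lt => eps eps0.
apply: filterS (ep (1 - ln eps)) => z; rewrite sub0r normrN ger0_norm ?expR_ge0 // => H.
by rewrite -[ltRHS]lnK ?posrE // ltr_expR; lra.
Qed.

(** The sum of a series divided by the size of its leading monomial tends to
    the normalized sum of the leading terms at the point of the torus. *)
Lemma leading_limit c E m0 (g : midx -> R[i]) (rho K : R) (a : 'rV[R[i]]_n) :
  leading_basis c E m0 -> 0 < rho -> rho <= 1 ->
  summable_at (fun m => g m * c m) rho K ->
  (forall e, leading E m0 e ->
    ccvg U (fun z => mono (mixed_point z) e / (cmod (mono (mixed_point z) m0))%:C)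
           (mono (mixed_point a) e / (cmod (mono (mixed_point a) m0))%:C)) ->
  ccvg U (fun z => psum (fun m => g m * c m) (mixed_point z)
                   / (cmod (mono (mixed_point z) m0))%:C)
         (psum (fun m => g m * (if leading E m0 m then c m else 0)) (mixed_point a)
            / (cmod (mono (mixed_point a) m0))%:C).
Proof.
move=> lb rho0 rho1 gK Ha.
have [_ mU] := lb_term lb (lb_mem lb).
have -> : psum (fun m => g m * (if leading E m0 m then c m else 0)) (mixed_point a)
            / (cmod (mono (mixed_point a) m0))%:C =
  \sum_(e <- E) g e * c e * (if leading E m0 e
     then mono (mixed_point a) e / (cmod (mono (mixed_point a) m0))%:C else 0).
  rewrite (psum_finite _ (lb_uniq lb)); last first.
    by move=> m; rewrite /leading; case: (m \in E) => //; rewrite /= mulr0 eqxx.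
  rewrite mulr_suml; apply: eq_bigr => e _.
  by case: ifP => _; rewrite ?mulr0 ?mul0r // mulrA.
have H1 : ccvg U (fun z => \sum_(e <- E) g e * c e *
    (mono (mixed_point z) e / (cmod (mono (mixed_point z) m0))%:C))
  (\sum_(e <- E) g e * c e * (if leading E m0 e
     then mono (mixed_point a) e / (cmod (mono (mixed_point a) m0))%:C else 0)).
  rewrite big_seq; under eq_fun do rewrite big_seq.
  apply: ccvg_sum => e eE; apply: ccvgM (ccvg_cst _) _.
  case: ifPn => [|/(not_leading lb eE) ep]; first exact: Ha.
  by apply: upos_ratio_cvg0 => //; have [] := lb_term lb eE.
pose M := (\max_(e <- E) mdeg e)%N.
pose eps z := \sum_i cmod ((z : 'rV[R[i]]_n) 0 i).
have eps_ge0 z : 0 <= eps z by apply: sumr_ge0 => i _; exact: cmod_ge0.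
have eps_cvg : eps z @[z --> U] --> 0.
  apply/cvgrPdist_lt => e e0.
  have e1 : 0 < e / n.+1%:R by rewrite divr_gt0.
  apply: filterS (U0 e1) => z ze.
  rewrite sub0r normrN ger0_norm ?eps_ge0 //.
  apply: (@le_lt_trans _ _ (\sum_(i < n) e / n.+1%:R)).
    by apply: ler_sum => i _; exact: ltW.
  rewrite sumr_const card_ord -[_ *+ n]mulr_natl mulrA ltr_pdivrMr // mulrC ltr_pM2l //.
  by rewrite ltr_nat ltnSn.
have H2 : ccvg U (fun z => (psum (fun m => g m * c m) (mixed_point z) -
     \sum_(e <- E) g e * c e * mono (mixed_point z) e)
     / (cmod (mono (mixed_point z) m0))%:C) 0.
  apply: (@ccvg_squeeze _ _ U _ _ _ (fun z => eps z * (rho ^- M.+1 * K))); last first.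
    rewrite -[X in _ --> X](mul0r (rho ^- M.+1 * K)).
    by apply: cvgM => //; exact: cvg_cst.
  have maxU : \forall z \near U, forall i : 'I_(size E),
      cmod (mono (mixed_point z) (nth m0 E i)) <= cmod (mono (mixed_point z) m0).
    by apply: filter_forall => i; apply: (lb_max lb); exact: mem_nth.
  have epsU : \forall z \near U, eps z <= rho.
    move/cvgrPdist_lt : eps_cvg => /(_ _ rho0); apply: filterS => z.
    by rewrite sub0r normrN => /ltW; apply: le_trans; exact: ler_norm.
  near=> z.
  have T0 : 0 < cmod (mono (mixed_point z) m0).
    by near: z; apply: filterS (@mono_supported_gt0 _ _ U _) => z; exact.
  rewrite subr0 cmodM cmodV cmod_real ger0_norm ?cmod_ge0 // ler_pdivrMr //.
  rewrite mulrC mulrA.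
  have epsge i : cmod (z 0 i) <= eps z.
    by rewrite /eps (bigD1 i) //= lerDl sumr_ge0 // => ? _; exact: cmod_ge0.
  apply: (psum_leading rho0 rho1 gK (lb_uniq lb)).
  - by move=> e eE; rewrite /M (big_rem e) //= leq_maxl.
  - by near: z.
  - by move=> x; rewrite mixed_point_cmod; case: x.
  - exact: eps_ge0.
  - exact: ltW.
  - move=> e eE; have mz : forall i : 'I_(size E),
      cmod (mono (mixed_point z) (nth m0 E i)) <= cmod (mono (mixed_point z) m0).
      by near: z.
    have eE' : (index e E < size E)%N by rewrite index_mem.
    by have := mz (Ordinal eE'); rewrite /= nth_index.
  - move=> m; rewrite !mulf_eq0 !negb_or => /andP[/andP[_ cm] mz].
    apply: (lb_dom lb cm); apply/supportedP => i iU.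
    apply: (@mono_mixed_eq0 _ _ z) => //.
    have /(_ i) : forall i, (z 0 i != 0) = (i \in usupp U).
      by near: z; exact: near_usupp.
    by rewrite (negbTE iU) => /negbFE/eqP.
rewrite -[X in ccvg _ _ X]add0r; apply: (ccvg_near _ (ccvgD H2 H1)); apply: nearW => z.
rewrite mulrBl mulr_suml -addrA -sumrN -big_split /= big1 ?addr0 // => e _.
rewrite [X in - X](_ : _ = g e * c e *
  (mono (mixed_point z) e / (cmod (mono (mixed_point z) m0))%:C)) ?mulrA //.
by rewrite addNr.
Unshelve. all: by end_near. Qed.

End LeadingTerms.

(** * Degeneration to a face *)

Lemma cancel_ratio (K : fieldType) (u v x y : K) : y != 0 ->
  u * (y / x) * (v / y) = u * v / x.
Proof. by move=> y0; move: x^-1 => x'; field. Qed.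

Section Degeneration.
Variables (R : realType) (n k : nat) (U : set_system 'rV[R[i]]_n).
Context {UU : UltraFilter U}.
(* [U] converges to the origin. *)
Hypothesis U0 : forall e : R, 0 < e ->
  \forall z \near U, forall i, cmod ((z : 'rV[R[i]]_n) 0 i) < e.
Variables (c : 'I_k -> mixed_series R n)
  (E : 'I_k -> seq {ffun 'I_n + 'I_n -> nat}) (m0 : 'I_k -> {ffun 'I_n + 'I_n -> nat}).
Hypothesis lb : forall j, leading_basis U (c j) (E j) (m0 j).
Hypothesis cvc : forall j, convergent (c j).

Let f j := mixed_eval (c j).

(** Critical zeros that accumulate at the origin along [U] degenerate to a
    critical zero of a face map in the torus.  The covectors are multiplied by
    the sizes of the leading terms of the components and normalized before
    passing to the limit. *)
Lemma degenerate_face :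
  (\forall z \near U, forall j, f j z = 0) ->
  (\forall z \near U, exists2 a, a != 0 & covector_at f z a) ->
  exists P : 'I_n -> nat, exists p : 'rV[R[i]]_n,
    [/\ forall i, (0 < P i)%N, forall i, p 0 i != 0,
      forall j, face_fun P (c j) p = 0 &
      exists2 a, a != 0 & covector_at (fun j => face_fun P (c j)) p a].
Proof.
move=> f0 fcrit.
have [P [P0 HP]] := leading_weight U0 lb.
have [p [p0 Hp]] := leading_point lb.
pose fs j : mixed_series R n := fun m => if leading U (E j) (m0 j) m then c j m else 0.
have fsE j : face_series P (c j) = fs j by apply/funext => m; rewrite HP.
pose t j (z : 'rV[R[i]]_n) : R := cmod (mono (mixed_point z) (m0 j)).
have mU j : supported U (m0 j) by have [] := lb_term (lb j) (lb_mem (lb j)).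
have p_gt0 j : 0 < t j p.
  rewrite /t cmod_mono_mixed; apply: prodr_gt0 => i _.
  by rewrite exprn_gt0 // cmod_gt0.
have radius j : exists rK : R * R, [/\ 0 < rK.1, rK.1 <= 1 & summable_at (c j) rK.1 rK.2].
  have [r [K [r0 rK]]] := convergent_summable (cvc j).
  exists (Num.min r 1, K); split=> /=; first by rewrite lt_min r0 ltr01.
    by rewrite ge_min lexx orbT.
  apply: summable_le rK => m; rewrite ler_wpM2l ?cmod_ge0 //.
  by apply: lerXn2r; rewrite ?nnegrE ?le_min ?ge_min ?lexx ?(ltW r0) ?ler01.
have [rK HrK] := boolp.choice radius.
have lim_f j : ccvg U (fun z => psum (c j) (mixed_point z) / (t j z)%:C)
    (psum (fs j) (mixed_point p) / (t j p)%:C).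
  have [r0 r1 sK] := HrK j.
  have E1 (h : mixed_series R n) : h = (fun m => 1 * h m).
    by apply/funext => m; rewrite mul1r.
  have := sK; rewrite {1}(E1 (c j)) => sK1.
  by rewrite {1}(E1 (c j)) (E1 (fs j)); exact: (leading_limit U0 (lb j) r0 r1 sK1 (Hp j)).
have lim_euler j x : ccvg U (fun z => psum (euler x (c j)) (mixed_point z) / (t j z)%:C)
    (psum (euler x (fs j)) (mixed_point p) / (t j p)%:C).
  have [r0 r1 sK] := HrK j.
  have r20 : 0 < (rK j).1 / 2 by rewrite divr_gt0.
  have r21 : (rK j).1 / 2 <= 1 by rewrite ler_pdivrMr // mul1r (le_trans r1) // ler1n.
  apply: (leading_limit U0 (lb j) r20 r21 _ (Hp j)).
  exact: (summable_euler x (ltW r0) sK).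
have face0 j : face_fun P (c j) p = 0.
  rewrite /face_fun fsE /mixed_eval; apply/eqP.
  suff : psum (fs j) (mixed_point p) / (t j p)%:C = 0.
    move/eqP; rewrite mulf_eq0 invr_eq0 => /orP[//|/eqP[] /eqP].
    by rewrite (gt_eqF (p_gt0 j)).
  apply: (ccvg_unique (lim_f j)); apply: (ccvg_near _ (ccvg_cst 0)).
  by apply: filterS f0 => z /(_ j); rewrite /f /mixed_eval => ->; rewrite mul0r.
(* A choice of covectors [al], and the normalized ones [be]. *)
have al_ex (z : 'rV[R[i]]_n) : exists a : 'rV[R[i]]_k,
    (exists2 a', a' != 0 & covector_at f z a') -> a != 0 /\ covector_at f z a.
  have [[a a0 az]|nz] := pselect (exists2 a, a != 0 & covector_at f z a).
    by exists a.
  by exists 0 => /nz.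
have [al Hal] := boolp.choice al_ex.
pose S (z : 'rV[R[i]]_n) : R := \sum_j cmod (al z 0 j) * t j z.
pose be j (z : 'rV[R[i]]_n) : R[i] := al z 0 j * (t j z / S z)%:C.
have tU : \forall z \near U, forall j, 0 < t j z.
  by apply: filterS (@mono_supported_gt0 _ _ U _) => z zm j; exact: zm _ (mU j).
have SU : \forall z \near U, 0 < S z.
  apply: filterS2 tU fcrit => z tz /Hal[az _].
  have [j aj] : exists j, al z 0 j != 0.
    apply/existsP; apply: contraR az => /existsPn H.
    by apply/eqP/rowP => j; rewrite mxE; apply/eqP; have := H j; rewrite negbK.
  rewrite /S (bigD1 j) //= ltr_pwDl //.
    by apply: mulr_gt0; [rewrite cmod_gt0 | exact: tz].
  by apply: sumr_ge0 => l _; apply: mulr_ge0; [exact: cmod_ge0 | exact: ltW].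
have cbe : \forall z \near U, forall j, cmod (be j z) = cmod (al z 0 j) * t j z / S z.
  apply: filterS2 tU SU => z tz Sz j.
  by rewrite /be cmodM cmod_real ger0_norm ?mulrA // divr_ge0 // ltW.
have be_ex j : exists b, ccvg U (be j) b.
  apply: (@ultra_ccvg _ _ U _ _ 1); apply: filterS3 tU SU cbe => z tz Sz ->.
  rewrite ler_pdivrMr // mul1r /S (bigD1 j) //= lerDl.
  by apply: sumr_ge0 => l _; apply: mulr_ge0; [exact: cmod_ge0 | exact: ltW].
have [b Hb] := boolp.choice be_ex.
have sum_b : \sum_j cmod (b j) = 1.
  have lim1 : \sum_j cmod (be j z) @[z --> U] --> \sum_j cmod (b j).
    apply: cvg_big => [|j _]; first by move=> ? ?; exact: add_continuous.
    exact: (ccvg_norm (Hb j)).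
  have lim2 : \sum_j cmod (be j z) @[z --> U] --> (1 : R).
    have c1 : (fun=> 1 : R) z @[z --> U] --> (1 : R) by exact: cvg_cst.
    apply: cvg_trans c1; apply: near_eq_cvg.
    apply: filterS2 SU cbe => z Sz cz.
    under eq_bigr do rewrite cz.
    by rewrite -mulr_suml divff // gt_eqF.
  exact: (cvg_unique _ lim1 lim2).
(* The limit of the critical point equations, multiplied by [conj z_i].  When
   [z_i] vanishes along [U] the leading terms do not involve this variable. *)
have rel i : \sum_j b j * (psum (euler (inr i) (fs j)) (mixed_point p) / (t j p)%:C) =
    - \sum_j conjc (b j) *
        conjc (psum (euler (inl i) (fs j)) (mixed_point p) / (t j p)%:C).
  case: (boolP (i \in usupp U)) => iU; last first.
    have z0 x j : (x = inl i \/ x = inr i) -> psum (euler x (fs j)) (mixed_point p) = 0.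
      move=> xi; apply: psum_eq0 => m; rewrite /euler /fs.
      case: ifP => [/andP[mE _]|_]; last by rewrite mulr0 mul0r.
      have [_ /supportedP/(_ i iU)[m1 m2]] := lb_term (lb j) mE.
      by case: xi => ->; rewrite ?m1 ?m2 !mul0r.
    by rewrite !big1 ?oppr0 // => j _; rewrite z0 ?mul0r ?conjc0 ?mulr0 //; [left | right].
  have lim1 : ccvg U (fun z => \sum_j be j z *
        (psum (euler (inr i) (c j)) (mixed_point z) / (t j z)%:C))
      (\sum_j b j * (psum (euler (inr i) (fs j)) (mixed_point p) / (t j p)%:C)).
    by apply: ccvg_sum => j _; exact: ccvgM (Hb j) (lim_euler j (inr i)).
  have lim2 : ccvg U (fun z => - \sum_j conjc (be j z) *
        conjc (psum (euler (inl i) (c j)) (mixed_point z) / (t j z)%:C))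
      (- \sum_j conjc (b j) *
        conjc (psum (euler (inl i) (fs j)) (mixed_point p) / (t j p)%:C)).
    apply: ccvgN; apply: ccvg_sum => j _.
    exact: ccvgM (ccvgJ (Hb j)) (ccvgJ (lim_euler j (inl i))).
  apply: (ccvg_unique lim1); apply: (ccvg_near _ lim2).
  have zr : \forall z \near U, forall j i, cmod ((z : 'rV[R[i]]_n) 0 i) <= (rK j).1 / 2.
    apply: filter_forall => j; have [r0 _ _] := HrK j.
    have r20 : 0 < (rK j).1 / 2 by rewrite divr_gt0.
    by apply: filterS (U0 r20) => z zr l; exact: ltW.
  near=> z.
  have tz : forall j, 0 < t j z by near: z.
  have Sz : 0 < S z by near: z.
  have zrz : forall j i, cmod (z 0 i) <= (rK j).1 / 2 by near: z.
  have zi : z 0 i != 0.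
    have /(_ i) -> // : forall i, (z 0 i != 0) = (i \in usupp U).
    by near: z; exact: near_usupp.
  have [_ cz] : al z != 0 /\ covector_at f z (al z) by apply: Hal; near: z.
  have dzE j := dz_mixed_eval (let: And3 _ _ s := HrK j in s) (zrz j) zi.
  have tE j (u v : R[i]) : u * (t j z / S z)%:C * (v / (t j z)%:C) = u * v / (S z)%:C.
    have : (t j z)%:C != 0 by apply/eqP => -[] /eqP; rewrite (gt_eqF (tz j)).
    by rewrite rmorphM fmorphV => /cancel_ratio; exact.
  apply/esym; have -> : \sum_j be j z *
        (psum (euler (inr i) (c j)) (mixed_point z) / (t j z)%:C) =
      conjc (z 0 i) / (S z)%:C * \sum_j al z 0 j * dzbar (f j) i z.
    rewrite mulr_sumr; apply: eq_bigr => j _.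
    by rewrite /be tE -(dzE j).2 /f; ring.
  rewrite (cz i) mulrN; congr (- _); rewrite mulr_sumr; apply: eq_bigr => j _.
  rewrite -[conjc (be j z) * _]conjM /be tE -(dzE j).1 /f; move: (dz _ _ _) => D.
  by rewrite !conjM conjc_inv conjc_real; ring.
exists P, p; split=> //.
exists (\row_j (b j / (t j p)%:C)).
  apply/eqP => /rowP b0; move: sum_b; rewrite big1 => [/eqP|j _].
    by rewrite eq_sym oner_eq0.
  have := b0 j; rewrite !mxE => /eqP; rewrite mulf_eq0 invr_eq0 => /orP[/eqP ->|/eqP[] /eqP].
    by rewrite cmod0.
  by rewrite (gt_eqF (p_gt0 j)).
move=> i; under eq_bigr do rewrite mxE; under [in RHS]eq_bigr do rewrite mxE.
pose rho := 2 * \sum_l cmod (p 0 l).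
have rho0 : 0 <= rho by rewrite mulr_ge0 // sumr_ge0 // => l _; exact: cmod_ge0.
have prho l : cmod (p 0 l) <= rho / 2.
  rewrite /rho mulrAC divff // mul1r (bigD1 l) //= lerDl.
  by apply: sumr_ge0 => ? _; exact: cmod_ge0.
have fsupp j m : fs j m != 0 -> m \in E j.
  by rewrite /fs /leading; case: (m \in E j) => //=; rewrite eqxx.
have dzE j :
    p 0 i * dz (face_fun P (c j)) i p = psum (euler (inl i) (fs j)) (mixed_point p) /\
    conjc (p 0 i) * dzbar (face_fun P (c j)) i p =
      psum (euler (inr i) (fs j)) (mixed_point p).
  rewrite /face_fun fsE.
  exact: dz_mixed_eval (summable_finite rho0 (lb_uniq (lb j)) (@fsupp j)) prho (p0 i).
have cp0 : conjc (p 0 i) != 0 by rewrite conjc_eq0.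
apply: (mulfI cp0); rewrite mulrN !mulr_sumr.
have := rel i; under eq_bigr do rewrite -(dzE _).2.
under [in RHS]eq_bigr do rewrite -(dzE _).1.
move=> rel_i; transitivity
  (\sum_j b j * (conjc (p 0 i) * dzbar (face_fun P (c j)) i p / (t j p)%:C)).
  by apply: eq_bigr => j _; ring.
rewrite rel_i; congr (- _); apply: eq_bigr => j _.
move: (dz _ _ _) => D; rewrite !conjM !conjc_inv conjc_real.
by move: (conjc _) (conjc _) (conjc _) (_^-1) => x1 x2 x3 x4; ring.
Unshelve. all: by end_near. Qed.

End Degeneration.

(** * Isolated critical zeros *)

Lemma near0_cmod (R : realType) (n : nat) (e : R) : 0 < e ->
  \forall z \near (0 : 'rV[R[i]^o]_n), forall i, cmod ((z : 'rV[R[i]]_n) 0 i) < e.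
Proof.
move=> e0.
have e0C : 0 < e%:C :> R[i] by rewrite ltcE /= eqxx.
have H (i : 'I_n) :
    \forall z \near (0 : 'rV[R[i]^o]_n), cmod ((z : 'rV[R[i]]_n) 0 i) < e.
  have := @coord_continuous (R[i] : numFieldType) 1 n 0 i (0 : 'rV[R[i]^o]_n).
  move/cvgrPdist_lt => /(_ _ e0C); apply: filterS => z.
  by rewrite mxE sub0r normrN ltC_Re.
exact: (@filter_forall _ _ _ _ _ H).
Qed.

Lemma superset_of_card (T : finType) (A : {set T}) (k : nat) :
  (#|A| <= k)%N -> (k <= #|T|)%N -> exists2 B : {set T}, A \subset B & #|B| = k.
Proof.
move=> Ak kT; exists (A :|: [set x in take (k - #|A|) (enum (~: A))]).
  exact: finset.subsetUl.
rewrite cardsU disjoint_setI0 ?cards0 ?subn0; last first.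
  rewrite disjoint_subset; apply/fintype.subsetP => x xA; rewrite !inE.
  by apply/negP => /mem_take; rewrite mem_enum inE xA.
rewrite cardsE (card_uniqP _) ?take_uniq ?enum_uniq // size_take -cardE.
have cA : (#|A| + #|~: A|)%N = #|T| by rewrite cardsC.
case: ltnP; move: Ak kT cA; lia.
Qed.

Theorem theorem2p13 (R : realType) (n k : nat) (F : mixed_germ R n k) :
  (1 <= k)%N -> (k < n)%N ->
  nondegenerate_germ F -> convenient_germ F -> positive_dim (V_ F) ->
  mixed_ICIS F.
Proof.
move=> k1 kn nd cv pd; split=> //.
apply: contrapT => nsub.
(* An ultrafilter on the critical zeros other than 0 that converges to 0. *)
pose A := [set z : 'rV[R[i]]_n | ~ ((Sigma_ F `&` V_ F) z -> z = 0)].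
pose G : set_system 'rV[R[i]]_n := within A (nbhs (0 : 'rV[R[i]^o]_n)).
have NF : Filter (nbhs (0 : 'rV[R[i]^o]_n)) by typeclasses eauto.
have GF : ProperFilter G.
  refine (Build_ProperFilter_ex _ (@within_filter 'rV[R[i]]_n A _ NF)).
  move=> B GB; apply: contrapT => nB; apply: nsub.
  have {}GB : \forall z \near (0 : 'rV[R[i]^o]_n), A z -> B z by exact: GB.
  apply: (filterS _ GB) => z AB zS; apply: contrapT => z0.
  by apply: nB; exists z; apply: AB => /(_ zS).
have [U [UU GU]] := ultraFilterLemma GF.
have nU (B : set 'rV[R[i]]_n) : (\forall z \near (0 : 'rV[R[i]^o]_n), B z) -> U B.
  by move=> nB; apply: GU; apply: filterS nB => z Bz _.
have UA : \forall z \near U, [/\ Sigma_ F z, V_ F z & z <> 0].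
  apply: GU; apply: nearW => z Az.
  have [zS|nS] := pselect ((Sigma_ F `&` V_ F) z); last by case: Az => /nS.
  by have [zs zv] := zS; split=> // z0; apply: Az.
have U0 (e : R) : 0 < e -> \forall z \near U, forall i, cmod ((z : 'rV[R[i]]_n) 0 i) < e.
  by move=> e0; apply: nU; exact: near0_cmod.
have j0 : 'I_k := Ordinal k1.
(* By the second convenience condition, the zeros have more than [k] nonzero
   coordinates along [U]. *)
have bigI : (k < #|usupp U|)%N.
  rewrite ltnNge; apply/negP => Ik.
  have [|I' II' cI'] := superset_of_card Ik; first by rewrite card_ord ltnW.
  have I'0 : (0 < #|I'|)%N by rewrite cI'.
  have /nU UI' := (cv j0 I' I'0).2 cI'.
  have : \forall z \near U, False.
    apply: filterS3 (@near_usupp _ _ U _) UA UI' => z zI [_ zV z0] zz.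
    apply: z0; apply/zz; split=> // i iI'.
    by apply/eqP; rewrite -[_ == _]negbK zI; apply: contra iI' => /(fintype.subsetP II').
  by move=> /filter_ex[].
have I0 : (0 < #|usupp U|)%N by exact: leq_ltn_trans bigI.
(* By the first one, no component vanishes on the corresponding coordinate
   subspace, hence each has a term that does not vanish along [U]. *)
have lb_ex j : exists Em : seq {ffun 'I_n + 'I_n -> nat} * {ffun 'I_n + 'I_n -> nat},
    leading_basis U (germ_coef F j) Em.1 Em.2.
  suff /leading_basis_exists [E [m0 Em]] :
      exists2 m, germ_coef F j m != 0 & supported U m by exists (E, m0).
  apply: contrapT => nm; apply: (cv j _ I0).1 => //.
  apply: (@filterE _ _ NF) => z zI; apply: psum_eq0 => m.
  have [->|cm] := eqVneq (germ_coef F j m) 0; first by rewrite mul0r.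
  have [->|mz] := eqVneq (mono (mixed_point z) m) 0; first by rewrite mulr0.
  case: nm; exists m => //; apply/supportedP => i /zI zi.
  exact: mono_mixed_eq0 zi mz.
have [Em HEm] := boolp.choice lb_ex.
have [||P [p [P0 p0 fp [a a0 pa]]]] := degenerate_face U0 HEm (germ_convergent F).
- by apply: filterS UA => z [_ zV _].
- by apply: filterS UA => z [zS _ _]; exact: critical_covector zS.
by apply: (nd P p P0 p0 fp); exists a.
Qed.
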